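(* Let $n\ge1$, $N\ge2$, $q\in[0,1)$ and let $(N_1,\dots,N_n)$ be type counts with $N_m\ge1$ for all $m$ and $N_1+\dots+N_n\le N$. Let $u$, $\mathbf v=(v_1,\dots,v_n)$, $\mathbf s^{(v)}=(s_1,\dots,s_n)$ be generic complex parameters (generic: the partition functions $F(\eta)$ below are finite and nonzero for all $\eta$ having at least one particle of each type; this holds off the zero set of finitely many polynomials). For $\eta\in\{0,\dots,n\}^N$ let $F(\eta)$ be the cylinder partition function with right boundary $\eta$ in which every vertex $(-m,j)$ carries the weight $w^{(-m)}_{s_m,z_m}$, $z_m=u/(v_mq^{1/2})$. Then there is a constant $Z=Z_{N_1,\dots,N_n}(u;\mathbf v;\mathbf s^{(v)})$, independent of $\eta$, such that for every configuration $\eta$ with type counts $(N_1,\dots,N_n)$ the unique stationary probability of $\eta$ for the multi-species ASEP on the ring restricted to the sector $(N_1,\dots,N_n)$ equals $$\mathrm{Prob}^{\mathrm{mASEP}}_{N_1,\dots,N_n}(\eta)=\frac{F(\eta)}{Z}.$$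
   Context: **Multi-species ASEP (mASEP) on the ring.** States $\eta=(\eta_1,\dots,\eta_N)\in\{0,\dots,n\}^N$ on $\mathbb Z/N\mathbb Z$; $\eta_k$ is the type at site $k$ ($0$ = hole). It is the continuous-time Markov chain in which, for each $k\in\mathbb Z/N\mathbb Z$ with $\eta_k\ne\eta_{k+1}$, the values at sites $k,k+1$ are swapped at rate $1$ if $\eta_k<\eta_{k+1}$ and rate $q$ if $\eta_k>\eta_{k+1}$. The type counts $N_m=\#\{j:\eta_j=m\}$, $1\le m\le n$, are conserved; in each sector (fixed $(N_1,\dots,N_n)$) the chain is irreducible and has a unique stationary distribution $\mathrm{Prob}^{\mathrm{mASEP}}_{N_1,\dots,N_n}$. **Queue vertex weights with horizontal spin 1/2.** Fix $1\le m\le n$. Let $\mathbf A,\mathbf C$ be $n$-tuples with $A_m=C_m=+\infty$ and all other coordinates in $\mathbb Z_{\ge0}$; $\mathbf e_i$ are standard basis vectors (adding or subtracting $\mathbf e_m$ changes nothing), $A_{[a,b]}=\sum_{i=a}^bA_i$ (zero if $a>b$). Let $k\in\{0\}\cup\{m+1,\dots,n\}$ (color entering from the left, $0$ = none) and $\ell\in\{0,\dots,n\}$ (color exiting right). The weight $w^{(-m)}_{s,z}(\mathbf A,k;\mathbf C,\ell)$ ($\mathbf A$ enters from below, $\mathbf C$ exits above) equals $\frac1{1-sz}$ times: - $1$ for $(\mathbf A,0;\mathbf A,0)$ and for $(\mathbf A,k;\mathbf A+\mathbf e_k,0)$, $k>m$; - $-sz(1-q^{A_\ell})q^{A_{[\ell+1,n]}}$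 for $(\mathbf A,0;\mathbf A-\mathbf e_\ell,\ell)$, $\ell>m$; - $-sz\,q^{A_{[m+1,n]}}$ for $(\mathbf A,0;\mathbf A,m)$; - $-s^2q^{A_{[m+1,n]}}$ for $(\mathbf A,k;\mathbf A+\mathbf e_k,m)$, $k>m$; - $-s(z-sq^{A_k})q^{A_{[k+1,n]}}$ for $(\mathbf A,k;\mathbf A,k)$, $k>m$; - $-sz(1-q^{A_\ell})q^{A_{[\ell+1,n]}}$ for $(\mathbf A,k;\mathbf A+\mathbf e_k-\mathbf e_\ell,\ell)$, $m<k<\ell$; - $-s^2(1-q^{A_\ell})q^{A_{[\ell+1,n]}}$ for $(\mathbf A,k;\mathbf A+\mathbf e_k-\mathbf e_\ell,\ell)$, $m<\ell<k$; and all other weights are $0$. (For $q=0$ the $z_m$ are regarded as the parameters.) **Cylinder partition function.** Vertices are $(-m,j)$, $1\le m\le n$, $j\in\mathbb Z/N\mathbb Z$. For $\eta\in\{0,\dots,n\}^N$ in which every color $1,\dots,n$ occurs, the partition function with right boundary $\eta$ is the (convergent) sum $$\sum\ \prod_{m=1}^n\prod_{j=1}^N w_{m,j}\bigl(\mathbf A^{(m,j)},h_{m+1,j};\mathbf A^{(m,j+1)},h_{m,j}\bigr),$$ where $w_{m,j}$ is the weight at $(-m,j)$, over all $h_{m,j}\in\{0,\dots,n\}$ with $h_{n+1,j}=0$, $h_{1,j}=\eta_j$, and all vertical tuples $\mathbf A^{(m,j)}$ ($j$ cyclic mod $N$) with $(\mathbf A^{(m,j)})_m=+\infty$, $(\mathbf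 A^{(m,j)})_i=0$ for $i<m$, $(\mathbf A^{(m,j)})_i\in\mathbb Z_{\ge0}$ for $i>m$. *)

(* Defs.v *)
From HB Require Import structures.
From mathcomp Require Import all_boot all_order all_algebra perm finmap.
From mathcomp Require Import all_classical all_reals all_analysis.
From mathcomp Require Export complex.
From mathcomp.analysis.showcase Require summability.

Set Implicit Arguments.
Unset Strict Implicit.
Unset Printing Implicit Defensive.

Import Order.TTheory GRing.Theory Num.Theory.
Import numFieldNormedType.Exports.

Local Open Scope ring_scope.
Local Open Scope complex_scope.

(* Types and line labels are elements of 'I_n.+1, 0 being the hole / absence  *)
(* of color. The color range {1, .., n} (also used to index columns, counts   *)
(* and parameters) is 'I_n, with m : 'I_n standing for the color              *)
(* m + 1 = lift ord0 m.                                                       *)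

Definition color n (m : 'I_n) : 'I_n.+1 := lift ord0 m.

Definition state n N := {ffun 'I_N -> 'I_n.+1}.

Section MultiSpeciesASEP.
Variables (R : realType) (n N : nat).
Implicit Types (q : R) (eta zeta : state n N).

(* ordS is the cyclic successor k |-> k + 1 mod N. *)
Definition swap_sites (k : 'I_N) eta : state n N :=
  [ffun j => eta (tperm k (ordS k) j)].

(* The sum over k matters: for N = 2 both bonds lead to the same state. *)
Definition jump_rate q eta zeta : R :=
  \sum_(k < N | (eta k != eta (ordS k)) && (zeta == swap_sites k eta))
    (if (eta k < eta (ordS k))%N then 1 else q).

Definition generator q eta zeta : R :=
  if zeta == eta then - \sum_(xi : state n N | xi != eta) jump_rate q eta xi
  else jump_rate q eta zeta.

Definition sector (Nm : 'I_n -> nat) : {set state n N} :=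
  [set eta : state n N | [forall m : 'I_n, #|[set j | eta j == color m]| == Nm m]].

Definition stationary_in_sector q (Nm : 'I_n -> nat)
    (pi : {ffun state n N -> R}) : Prop :=
  [/\ forall eta, 0 <= pi eta,
      forall eta, eta \notin sector Nm -> pi eta = 0,
      \sum_eta pi eta = 1
    & forall zeta, \sum_eta pi eta * generator q eta zeta = 0].

End MultiSpeciesASEP.

(* A tuple (A_1, .., A_n) of elements of {0, 1, ..} + {+oo}; None is +oo. *)
Definition vtuple n := {ffun 'I_n -> option nat}.

Section QueueWeights.
Variables (R : realType) (n : nat).
Implicit Types (q : R) (s z : R[i]) (A C : vtuple n) (m i : 'I_n).

Definition incr A i : vtuple n :=
  [ffun x => if x == i then omap succn (A x) else A x].

(* Truncated at 0: every weight using A - e_i has the factor 1 - q ^ A_i,     *)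
(* which vanishes when A_i = 0.                                               *)
Definition decr A i : vtuple n :=
  [ffun x => if x == i then omap predn (A x) else A x].

(* q ^ a, with q ^ oo = 0 as 0 <= q < 1. *)
Definition qpow q (a : option nat) : R[i] :=
  if a is Some a' then (q ^+ a')%:C else 0.

(* q ^ A_[i+1, n] *)
Definition qtail q A i : R[i] := \prod_(x < n | (i < x)%N) qpow q (A x).

(* The weight w^(-m)_(s,z)(A, k; C, l). *)
Definition queue_weight q s z m A (k : 'I_n.+1) C (l : 'I_n.+1) : R[i] :=
  (1 - s * z)^-1 *
  match unlift ord0 k, unlift ord0 l with
  | None, None => if C == A then 1 else 0
  | Some k', None => if (m < k')%N && (C == incr A k') then 1 else 0
  | None, Some l' =>
      if (l' == m) && (C == A) then - s * z * qtail q A m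
      else if (m < l')%N && (C == decr A l') then
        - s * z * (1 - qpow q (A l')) * qtail q A l'
      else 0
  | Some k', Some l' =>
      if ~~ (m < k')%N then 0
      else if (l' == m) && (C == incr A k') then - s ^+ 2 * qtail q A m
      else if (l' == k') && (C == A) then
        - s * (z - s * qpow q (A k')) * qtail q A k'
      else if (k' < l')%N && (C == decr (incr A k') l') then
        - s * z * (1 - qpow q (A l')) * qtail q A l'
      else if [&& (m < l')%N, (l' < k')%N & C == decr (incr A k') l'] then
        - s ^+ 2 * (1 - qpow q (A l')) * qtail q A l'
      else 0
  end.

End QueueWeights.

Section CylinderPartitionFunction.
Variables (R : realType) (n N : nat).
Implicit Types (q : R) (s z : 'I_n -> R[i]) (eta : state n N).

(* Horizontal labels h and vertical tuples A. The row r : 'I_n.+1 of h holds  *)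
(* h_{r+1, j}, so that vertex (m, j) is entered by h (lift ord0 m, j) and     *)
(* exited by h (widen_ord (leqnSn n) m, j).                                   *)
Definition edge_labels : Type :=
  ({ffun 'I_n.+1 * 'I_N -> 'I_n.+1} * {ffun 'I_n * 'I_N -> vtuple n})%type.
HB.instance Definition _ := Choice.on edge_labels.

Definition admissible eta (c : edge_labels) : bool :=
  [&& [forall j, c.1 (ord0, j) == eta j],
      [forall j, c.1 (ord_max, j) == ord0]
    & [forall m : 'I_n, forall j : 'I_N, forall i : 'I_n,
        if (i < m)%N then c.2 (m, j) i == Some 0%N
        else if i == m then c.2 (m, j) i == None
        else c.2 (m, j) i != None]].

Definition config_weight q s z eta (c : edge_labels) : R[i] :=
  if admissible eta c then
    \prod_(m < n) \prod_(j < N)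
      queue_weight q (s m) (z m) m
        (c.2 (m, j)) (c.1 (lift ord0 m, j))
        (c.2 (m, ordS j)) (c.1 (widen_ord (leqnSn n) m, j))
  else 0.

(* The net of sums over finite sets of configurations, ordered by inclusion;  *)
(* its convergence is unconditional (equivalently absolute) summability.      *)
Definition partition_sums q s z eta : set_system R[i]^o :=
  (summability.partial_sum (config_weight q s z eta) @ summability.totally)%classic.

Definition partition_finite q s z eta : Prop :=
  cvg (partition_sums q s z eta).

(* Meaningful when [partition_finite q s z eta]. *)
Definition partition_function q s z eta : R[i] :=
  lim (partition_sums q s z eta).

Definition all_colors eta : bool :=
  [forall m : 'I_n, exists j : 'I_N, eta j == color m].

(* The first clause says that no weight has a zero denominator. *)
Definition generic_params q s z : Prop :=
  (forall m, 1 - s m * z m != 0) /\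
  forall eta, all_colors eta ->
    partition_finite q s z eta /\ partition_function q s z eta != 0.

End CylinderPartitionFunction.

(* Main.v *)
(** Sites are read along the cylinder, so the column [m] acts on functions of
    states as a transfer operator [T_m], the trace over the vertical tuples of a
    product of [N] one-site operators.  A local exchange relation (the derivative
    of the Yang-Baxter equation at equal spectral parameters) says that the
    two-site mASEP generator passes through two consecutive one-site operators up
    to [D (x) L - L (x) D], where [D] is, up to the factor [1 - q], the logarithmic
    derivative in [z] of the one-site operator [L].  Around the ring these
    corrections telescope, hence [T_m] intertwines the generators on its input
    and output states.  Starting from the empty state, which is stationary,
    [F = T_1 ... T_n] is annihilated by the generator.

    The traces are infinite sums.  They are approximated by sums over tuples with
    entries at most [K]; since color [m] exits somewhere, with weight
    [q^(A_[m+1, n])], these are bounded and the failure of the intertwining at the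
    boundary of the box tends to [0].

    Swapping ascents sorts any state, even for [q = 0], so all nonzero nonnegative
    solutions in a sector charge its unique sorted state; the solution space is
    therefore a line, and it is spanned by the real or imaginary part of [F].  *)

Require Import Defs.
From mathcomp Require Import all_boot all_order all_algebra perm finmap.
From mathcomp Require Import all_classical all_reals all_analysis.
From mathcomp Require Import zify ring lra.
Import Order.TTheory GRing.Theory Num.Theory.

Set Implicit Arguments.
Unset Strict Implicit.
Unset Printing Implicit Defensive.

Local Open Scope ring_scope.
Local Open Scope complex_scope.

(** * The generator and its kernel *)

Definition rate (K : nzRingType) (q : K) (a b : nat) : K :=
  if (a < b)%N then 1 else if (b < a)%N then q else 0.

(** Gain minus loss at [eta]: the master equation. The ring is left free, so as to cover real
    probabilities and complex partition functions. *)
Definition flow (K : nzRingType) n N (q : K) (F : state n N -> K)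
    (eta : state n N) : K :=
  \sum_(k < N) (rate q (eta (ordS k)) (eta k) * F (swap_sites k eta)
                - rate q (eta k) (eta (ordS k)) * F eta).

(** * Swaps, summation by parts and sorted states *)

Section Swaps.
Variables (n N : nat).
Implicit Types (eta : state n N) (k : 'I_N).

Lemma swap_sitesK k : involutive (@swap_sites n N k).
Proof. by move=> eta; apply/ffunP => j; rewrite !ffunE tpermK. Qed.

Lemma swap_sitesL k eta : swap_sites k eta k = eta (ordS k).
Proof. by rewrite ffunE tpermL. Qed.

Lemma swap_sitesR k eta : swap_sites k eta (ordS k) = eta k.
Proof. by rewrite ffunE tpermR. Qed.

Lemma card_swap_sites k eta (c : 'I_n.+1) :
  #|[set j | swap_sites k eta j == c]| = #|[set j | eta j == c]|.
Proof.
rewrite -(card_imset [set j | eta j == c] (@perm_inj _ (tperm k (ordS k)))).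
apply: eq_card => j; rewrite inE ffunE; apply/idP/imsetP => [jc|[i + ->]].
  by exists (tperm k (ordS k) j); rewrite ?inE ?tpermK.
by rewrite inE tpermK.
Qed.

Lemma sector_swap Nm k eta :
  (swap_sites k eta \in sector N Nm) = (eta \in sector N Nm).
Proof. by rewrite !inE; apply: eq_forallb => m; rewrite card_swap_sites. Qed.

Lemma sum_swap (K : nzRingType) k (f : state n N -> K) :
  \sum_(eta : state n N) f (swap_sites k eta) = \sum_(eta : state n N) f eta.
Proof. by rewrite [RHS](reindex_inj (inv_inj (swap_sitesK k))). Qed.

(** Summation by parts: substituting the involution [swap_sites k] in the gain terms moves the
    generator from [F] to the test function [T]. *)
Lemma flow_adjoint (K : comNzRingType) (q : K) (F T : state n N -> K) :
  \sum_(eta : state n N) flow q F eta * T eta =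
  \sum_(eta : state n N) F eta *
    \sum_(k < N) rate q (eta k) (eta (ordS k)) * (T (swap_sites k eta) - T eta).
Proof.
transitivity (\sum_(k < N) \sum_(eta : state n N)
    (rate q (eta (ordS k)) (eta k) * F (swap_sites k eta) * T eta
     - rate q (eta k) (eta (ordS k)) * F eta * T eta)).
  rewrite exchange_big /=; apply: eq_bigr => eta _.
  by rewrite mulr_suml; apply: eq_bigr => k _; rewrite mulrBl.
transitivity (\sum_(k < N) \sum_(eta : state n N)
    (rate q (eta k) (eta (ordS k)) * F eta * T (swap_sites k eta)
     - rate q (eta k) (eta (ordS k)) * F eta * T eta)).
  apply: eq_bigr => k _; rewrite !big_split /=; congr (_ + _).
  rewrite -(sum_swap k); apply: eq_bigr => eta _.
  by rewrite swap_sitesK swap_sitesL swap_sitesR.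
rewrite exchange_big; apply: eq_bigr => eta _.
by rewrite mulr_sumr; apply: eq_bigr => k _; ring.
Qed.

Lemma sum_flow (K : comNzRingType) (q : K) (F : state n N -> K) :
  \sum_(eta : state n N) flow q F eta = 0.
Proof.
under eq_bigr do rewrite -[flow _ _ _]mulr1.
rewrite (flow_adjoint q F (fun=> 1)); apply: big1 => eta _.
by rewrite big1 ?mulr0 // => k _; rewrite subrr mulr0.
Qed.

Definition antitone eta :=
  forall j k : 'I_N, (j <= k)%N -> (eta k <= eta j)%N.

(** [Nm] records no holes; their number is what the other counts leave of [N]. *)
Lemma sector_count Nm eta eta' : eta \in sector N Nm -> eta' \in sector N Nm ->
  forall c : 'I_n.+1, #|[set j | eta j == c]| = #|[set j | eta' j == c]|.
Proof.
rewrite !inE => /forallP s1 /forallP s2 c.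
have pos (m : 'I_n) : #|[set j | eta j == color m]| = #|[set j | eta' j == color m]|.
  by rewrite (eqP (s1 m)) (eqP (s2 m)).
case: (unliftP ord0 c) => [m ->|->]; first exact: pos.
have tot (xi : state n N) : (\sum_(d < n.+1) #|[set j | xi j == d]| = N)%N.
  under eq_bigr => d _ do rewrite cardsE -sum1_card.
  by rewrite -[RHS](card_ord N) -sum1_card [RHS](partition_big xi predT).
have := etrans (tot eta) (esym (tot eta')); rewrite !big_ord_recl /=.
by under eq_bigr do rewrite pos; move/addIn.
Qed.

Lemma antitone_unique Nm eta eta' : eta \in sector N Nm -> eta' \in sector N Nm ->
  antitone eta -> antitone eta' -> eta = eta'.
Proof.
move=> s1 s2 a1 a2; apply/ffunP => j0.
suff eqc : [seq eta j | j <- enum 'I_N] = [seq eta' j | j <- enum 'I_N].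
  by move/eq_in_map: eqc; apply; rewrite mem_enum.
pose geo := fun a b : 'I_n.+1 => (b <= a)%N.
have srt (xi : state n N) : antitone xi -> sorted geo [seq xi j | j <- enum 'I_N].
  move=> ax; rewrite sorted_map; apply: (sub_sorted (e := fun i j : 'I_N => (i <= j)%N)).
    by move=> i j /=; apply: ax.
  by have := iota_sorted 0 N; rewrite -val_enum_ord sorted_map.
apply: (sorted_eq (leT := geo)); [| |exact: srt|exact: srt|].
- by move=> b a c ab bc; apply: leq_trans bc ab.
- by move=> a b /andP[ab ba]; apply/val_inj/eqP; rewrite eqn_leq; apply/andP.
- have cnt (xi : state n N) c :
      count_mem c [seq xi j | j <- enum 'I_N] = #|[set j | xi j == c]|.
    rewrite count_map cardE -(size_filter) /enum_mem; congr size.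
    by rewrite -filter_predI; apply: eq_filter => i; rewrite /= !inE andbT.
  by apply/allP => c _ /=; rewrite !cnt (sector_count s1 s2).
Qed.

End Swaps.

(** * Positivity and the one-dimensional kernel *)

Section Stationarity.
Variables (R : realType) (n N : nat) (q : R) (Nm : 'I_n -> nat).
Hypothesis q0 : 0 <= q.
Implicit Types (eta zeta : state n N) (g p : state n N -> R).

Lemma rate_ge0 a b : 0 <= rate q a b.
Proof. by rewrite /rate; do 2?case: ifP. Qed.

Lemma flow_generator (F : state n N -> R) zeta :
  \sum_(eta : state n N) F eta * generator q eta zeta = flow q F zeta.
Proof.
have rateE (xi : state n N) k : (if xi k != xi (ordS k) then
      if (xi k < xi (ordS k))%N then 1 else q else 0) = rate q (xi k) (xi (ordS k)).
  by rewrite /rate -val_eqE /=; case: ltngtP.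
have swapN (xi : state n N) k : xi k != xi (ordS k) -> swap_sites k xi != xi.
  by apply: contra => /eqP e; rewrite -{1}e swap_sitesL.
rewrite (bigD1 zeta) //= /generator eqxx.
rewrite [X in _ + X](eq_bigr (fun eta => F eta * jump_rate q eta zeta)); last first.
  by move=> eta; rewrite eq_sym => /negPf->.
rewrite addrC /flow big_split /= sumrN -mulr_suml.
congr (_ + _).
  transitivity (\sum_(eta | eta != zeta) \sum_(k < N)
      (if (eta k != eta (ordS k)) && (zeta == swap_sites k eta) then
       F eta * rate q (eta k) (eta (ordS k)) else 0)).
    apply: eq_bigr => eta _; rewrite /jump_rate big_mkcond /= mulr_sumr.
    apply: eq_bigr => k _; rewrite -rateE.
    by case: (eta k != eta (ordS k)); case: ifP; rewrite ?mulr0.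
  rewrite exchange_big /=; apply: eq_bigr => k _.
  have [e|ne] := boolP (zeta k == zeta (ordS k)).
    rewrite -[in RHS](eqP e) /rate ltnn mul0r big1 // => eta _.
    case: ifP => // /andP[ek /eqP ez]; move: e.
    by rewrite ez swap_sitesL swap_sitesR eq_sym (negPf ek).
  rewrite (bigD1 (swap_sites k zeta)) /=; last exact: swapN.
  rewrite swap_sitesL swap_sitesR swap_sitesK eqxx eq_sym ne /= mulrC.
  rewrite big1 ?addr0 // => eta /andP[_ en]; case: ifP => // /andP[_ /eqP ez].
  by rewrite ez swap_sitesK eqxx in en.
rewrite mulrN mulrC; congr (- (_ * _)).
transitivity (\sum_(xi | xi != zeta) \sum_(k < N)
      (if (zeta k != zeta (ordS k)) && (xi == swap_sites k zeta) then
       rate q (zeta k) (zeta (ordS k)) else 0)).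
  apply: eq_bigr => xi _; rewrite /jump_rate big_mkcond /=.
  apply: eq_bigr => k _; rewrite -rateE.
  by case: (zeta k != zeta (ordS k)).
rewrite exchange_big /=; apply: eq_bigr => k _.
have [e|ne] := boolP (zeta k == zeta (ordS k)).
  by rewrite (eqP e) /rate ltnn big1.
rewrite (bigD1 (swap_sites k zeta)) /=; last exact: swapN.
by rewrite eqxx big1 ?addr0 // => xi /andP[_ /negPf->].
Qed.

(** The triangle inequality makes the flow of [|g|] nonnegative; its total is [0], so it vanishes
    everywhere. *)
Lemma flow_norm g : (forall eta, flow q g eta = 0) ->
  forall eta, flow q (fun eta => `|g eta|) eta = 0.
Proof.
move=> gk; pose F eta := flow q (fun eta => `|g eta|) eta.
have F0 eta : 0 <= F eta.
  have := gk eta; rewrite /F /flow !big_split /= !sumrN -!mulr_suml => /eqP.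
  rewrite subr_eq0 subr_ge0 => /eqP gkE.
  rewrite -[X in X * _]ger0_norm; last by apply: sumr_ge0 => k _; exact: rate_ge0.
  rewrite -normrM -gkE (le_trans (ler_norm_sum _ _ _)) //.
  by apply: ler_sum => k _; rewrite normrM (ger0_norm (rate_ge0 _ _)).
have /eqP := sum_flow q (fun eta => `|g eta|); rewrite psumr_eq0; last first.
  by move=> eta _; apply: F0.
by move=> /allP all0 eta; apply/eqP/all0; rewrite mem_index_enum.
Qed.

(** If [p] vanished after the swap, the balance there would be a sum of nonnegative inflows equal to
    [0], although the inflow from [eta] has rate [1]. *)
Lemma flow_pos_swap p eta k : (forall eta, 0 <= p eta) ->
  (forall eta, flow q p eta = 0) -> (eta k < eta (ordS k))%N -> 0 < p eta ->
  0 < p (swap_sites k eta).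
Proof.
move=> p0 pk lt_k pe; rewrite lt_def p0 andbT; apply: contraTneq isT => p0'.
have := pk (swap_sites k eta); rewrite /flow; under eq_bigr do rewrite p0' mulr0 subr0.
move/eqP; rewrite psumr_eq0 => [/allP/(_ k)|j _]; last by rewrite mulr_ge0 ?rate_ge0.
rewrite mem_index_enum swap_sitesL swap_sitesR swap_sitesK /rate lt_k mul1r.
by move=> /(_ isT); rewrite gt_eqF.
Qed.

(* Swapping an ascent at a bond [k < k.+1] lowers [\sum_j j * eta j], so a state *)
(* of the support minimizing this quantity has no ascent.                       *)
Lemma flow_pos_antitone p eta0 : (forall eta, 0 <= p eta) ->
  (forall eta, eta \notin sector N Nm -> p eta = 0) ->
  (forall eta, flow q p eta = 0) -> 0 < p eta0 ->
  exists eta, [/\ eta \in sector N Nm, antitone eta & 0 < p eta].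
Proof.
move=> p0 psec pk pe0.
pose ht (eta : state n N) := (\sum_(j < N) j * eta j)%N.
pose eta := [arg min_(xi < eta0 | 0 < p xi) ht xi].
have [pe min_e] : 0 < p eta /\ forall xi, 0 < p xi -> (ht eta <= ht xi)%N.
  by rewrite /eta; case: arg_minnP.
exists eta; split=> //.
  by apply: contraTT pe => /psec ->; rewrite ltxx.
(* Here [ordS j] is [j + 1] without wrapping, so the bond closing the ring never enters. *)
have step (j k : 'I_N) : k = j.+1 :> nat -> (eta k <= eta j)%N.
  move=> kj; rewrite leqNgt; apply/negP => lt_jk.
  have kS : k = ordS j by apply/val_inj; rewrite /= modn_small -?kj.
  have jk : k != j by rewrite -val_eqE /= kj; lia.
  rewrite kS in lt_jk jk; have := min_e _ (flow_pos_swap p0 pk lt_jk pe).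
  rewrite leqNgt => /negP; apply.
  rewrite /ht (bigD1 j) //= (bigD1 (ordS j)) //=.
  rewrite [X in (_ < X)%N](bigD1 j) //= [X in (_ < _ + X)%N](bigD1 (ordS j)) //=.
  rewrite swap_sitesL swap_sitesR.
  rewrite (eq_bigr (fun i : 'I_N => i * eta i)%N) => [|i /andP[ij iS]]; last first.
    by rewrite ffunE tpermD // eq_sym.
  have -> : (j.+1 %% N)%N = j.+1 by rewrite modn_small // -kj.
  rewrite !mulSn; set S := bigop.body _ _ _; clearbody S; clear -lt_jk.
  by move: (nat_of_ord (eta j)) (nat_of_ord (eta (ordS j))) (nat_of_ord j) lt_jk; lia.
suff dist d (j k : 'I_N) : k = (j + d)%N :> nat -> (eta k <= eta j)%N.
  by move=> j k jk; apply: (dist (k - j)%N); rewrite subnKC.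
elim: d j k => [|d IH] j k kj.
  by have -> : k = j by apply/val_inj; rewrite /= kj addn0.
have jdN : (j + d < N)%N by have := ltn_ord k; lia.
by apply: leq_trans (IH j (Ordinal jdN) _) => //; apply: step; rewrite /= kj addnS.
Qed.

(** The stationary law is [|g|], normalized. Another solution, minus the multiple of [pi] agreeing
    with it at the sorted state [om], vanishes at [om]; were it nonzero, its absolute value would
    charge a sorted state, which can only be [om]. *)
Lemma kernel_stationary g : (forall eta, eta \notin sector N Nm -> g eta = 0) ->
  (forall eta, flow q g eta = 0) -> (exists eta, g eta != 0) ->
  exists pi : {ffun state n N -> R},
    unique (stationary_in_sector q Nm) pi /\
    forall g', (forall eta, eta \notin sector N Nm -> g' eta = 0) ->
      (forall eta, flow q g' eta = 0) -> exists c, forall eta, g' eta = c * pi eta.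
Proof.
move=> gs gk [eta1 g1].
have g1' : 0 < `|g eta1| by rewrite normr_gt0.
have gs' eta : eta \notin sector N Nm -> `|g eta| = 0 by move=> /gs ->; rewrite normr0.
have [om [oms oma omp]] :=
  flow_pos_antitone (fun eta => normr_ge0 (g eta)) gs' (flow_norm gk) g1'.
pose S := \sum_(eta : state n N) `|g eta|.
have S0 : 0 < S.
  by rewrite /S (bigD1 om) //= ltr_pwDl // sumr_ge0.
pose pi : {ffun state n N -> R} := [ffun eta => `|g eta| / S].
have flowM (c : R) f eta : flow q (fun eta => c * f eta) eta = c * flow q f eta.
  by rewrite /flow mulr_sumr; apply: eq_bigr => k _; ring.
have flowB f1 f2 eta : flow q (fun eta => f1 eta - f2 eta) eta =
    flow q f1 eta - flow q f2 eta.
  by rewrite /flow -sumrB; apply: eq_bigr => k _; ring.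
have pik eta : flow q pi eta = 0.
  have -> : pi = (fun eta => S^-1 * `|g eta|) :> (state n N -> R).
    by apply/funext => xi; rewrite ffunE mulrC.
  by rewrite (flowM _ (fun xi => `|g xi|)) (flow_norm gk) mulr0.
have pis eta : eta \notin sector N Nm -> pi eta = 0.
  by move=> /gs' ge; rewrite ffunE ge mul0r.
have piom : 0 < pi om by rewrite ffunE divr_gt0.
have ker g' : (forall eta, eta \notin sector N Nm -> g' eta = 0) ->
    (forall eta, flow q g' eta = 0) -> exists c, forall eta, g' eta = c * pi eta.
  move=> g's g'k; exists (g' om / pi om) => eta.
  pose d xi := g' xi - g' om / pi om * pi xi.
  have dk xi : flow q d xi = 0 
    by rewrite flowB (flowM _ (fun xi => pi xi)) g'k pik mulr0 subrr.
  have ds xi : xi \notin sector N Nm -> d xi = 0.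
    by move=> xs; rewrite /d (g's _ xs) (pis _ xs) mulr0 subrr.
  apply/eqP; rewrite -subr_eq0 -/(d eta); apply: contraT => dn.
  have dn' : 0 < `|d eta| by rewrite normr_gt0.
  have ds' xi : xi \notin sector N Nm -> `|d xi| = 0 by move=> /ds ->; rewrite normr0.
  have [om' [oms' oma']] :=
    flow_pos_antitone (fun eta => normr_ge0 (d eta)) ds' (flow_norm dk) dn'.
  by rewrite (antitone_unique oms' oms oma' oma) /d divfK ?gt_eqF // subrr normr0 ltxx.
have pi1 : \sum_(eta : state n N) pi eta = 1.
  by under eq_bigr do rewrite ffunE; rewrite -mulr_suml divff ?gt_eqF.
exists pi; split=> //; split.
  split=> // [eta|zeta]; first by rewrite ffunE divr_ge0 // ltW.
  by rewrite flow_generator.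
move=> pi' [_ pi's pi'1 pi'k].
have [c pi'E] := ker pi' pi's (fun eta => etrans (esym (flow_generator _ _)) (pi'k eta)).
apply/ffunP => eta; rewrite pi'E.
suff -> : c = 1 by rewrite mul1r.
by move: pi'1; under eq_bigr do rewrite pi'E; rewrite -mulr_sumr pi1 mulr1.
Qed.

End Stationarity.

Lemma sector_nonempty n N (Nm : 'I_n -> nat) :
  (\sum_(m < n) Nm m <= N)%N -> exists eta : state n N, eta \in sector N Nm.
Proof.
move=> le_N.
pose t := flatten [seq nseq (Nm m) (color m) | m <- enum 'I_n]
  ++ nseq (N - \sum_(m < n) Nm m) ord0.
have szt : size t = N.
  rewrite size_cat size_nseq size_flatten /shape -map_comp sumnE big_map big_enum /=.
  by under eq_bigr do rewrite size_nseq; rewrite subnKC.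
exists [ffun j : 'I_N => nth ord0 t j]; rewrite inE; apply/forallP => m.
have -> : #|[set j : 'I_N | [ffun j : 'I_N => nth ord0 t j] j == color m]|
    = count_mem (color m) t.
  have tE : t = [seq nth ord0 t (val j) | j <- enum 'I_N].
    by rewrite map_comp val_enum_ord -szt -/(mkseq _ _) mkseq_nth.
  rewrite [in RHS]tE count_map cardE -size_filter /enum_mem -filter_predI.
  by congr size; apply: eq_filter => i; rewrite /= !inE ffunE andbT.
rewrite count_cat count_nseq /= count_flatten -map_comp sumnE big_map big_enum /=.
rewrite (bigD1 m) //= count_nseq /= eqxx mul1n big1 => [|i im].
  by rewrite addn0 mul0n addn0.
by rewrite count_nseq /= (inj_eq lift_inj) (negPf im).
Qed.

(** * The local exchange relation *)

Definition oadd (b : bool) (a : option nat) : option nat := omap (addn b) a.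

Lemma oadd_inj b : injective (oadd b).
Proof. by move=> [x|] [y|] //= [/addnI ->]. Qed.

Lemma oaddC b c a : oadd b (oadd c a) = oadd c (oadd b a).
Proof. by case: a => //= a; rewrite addnCA. Qed.

(** * Conservation of colors at a vertex *)

Section Balance.
Variable n : nat.
Implicit Types (A B C : vtuple n) (k l : nat).

(** [A + e_k = C + e_l] without subtraction, [+oo] absorbing. Label [0] matches no coordinate and
    adds nothing. *)
Definition balanced A k C l : bool :=
  [forall x : 'I_n, oadd (x.+1 == k) (A x) == oadd (x.+1 == l) (C x)].

Lemma balancedP A k C l :
  reflect (forall x : 'I_n, oadd (x.+1 == k) (A x) = oadd (x.+1 == l) (C x))
          (balanced A k C l).
Proof. by apply: (iffP forallP) => h x; apply/eqP/h. Qed.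

Lemma balanced_fun A k l C C' : balanced A k C l -> balanced A k C' l -> C = C'.
Proof.
move=> /balancedP bC /balancedP bC'; apply/ffunP => x.
by apply: (@oadd_inj (x.+1 == l)); rewrite -bC -bC'.
Qed.

Definition balanced2 A k1 k2 C l1 l2 : bool :=
  [forall x : 'I_n, oadd (x.+1 == k1) (oadd (x.+1 == k2) (A x)) ==
                    oadd (x.+1 == l1) (oadd (x.+1 == l2) (C x))].

Lemma balanced2Cl A k1 k2 C l1 l2 :
  balanced2 A k1 k2 C l1 l2 = balanced2 A k2 k1 C l1 l2.
Proof. by apply: eq_forallb => x; rewrite oaddC. Qed.

Lemma balanced2Cr A k1 k2 C l1 l2 :
  balanced2 A k1 k2 C l1 l2 = balanced2 A k1 k2 C l2 l1.
Proof. by apply: eq_forallb => x; rewrite [X in _ == X]oaddC. Qed.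

(** Given balance at the first vertex, the condition at the second depends on the outer data only,
    symmetrically in inputs and in outputs. *)
Lemma balanced_comp A k1 B l1 k2 C l2 : balanced A k1 B l1 ->
  balanced B k2 C l2 = balanced2 A k1 k2 C l1 l2.
Proof.
move/balancedP => bB; apply: eq_forallb => x.
rewrite (oaddC (x.+1 == k1) (x.+1 == k2)) bB (oaddC (x.+1 == k2) (x.+1 == l1)).
by rewrite (inj_eq (@oadd_inj _)).
Qed.

(* The tuple [A + e_k - e_l]; labels are shifted by one with respect to the *)
(* coordinates, and the truncation at [0] only occurs where weights vanish. *)
Definition vnext A k l : vtuple n :=
  [ffun x : 'I_n => omap (subn^~ (x.+1 == l)) (oadd (x.+1 == k) (A x))].

Lemma balanced_vnext A k l :
  (forall x : 'I_n, x.+1 = l -> k != l -> A x != Some 0%N) ->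
  balanced A k (vnext A k l) l.
Proof.
move=> Apos; apply/balancedP => x; rewrite ffunE.
case: (A x) (Apos x) => //= a apos; congr Some; move: apos.
have [<- /(_ erefl)|] := eqVneq x.+1 l; last by rewrite subn0.
by have [_ _|_ /(_ isT)] := eqVneq k x.+1; case: a => //= a; rewrite ?subn1 ?addn0.
Qed.

End Balance.

(** * Polynomial form of the weights *)

Section LocalRelation.
Variable n : nat.

Section Entries.
Variables (K : comNzRingType) (q s z : K).
Implicit Types (A : vtuple n) (X : nat -> K).

Definition qexp (a : option nat) : K := if a is Some b then q ^+ b else 0.

(** This is [q^(A_[j+1, n])] in one-based colors. An infinite coordinate contributes [0], which
    merges the special weights for the exit of color [m] into the general formula. *)
Definition qtl A (j : nat) : K := \prod_(x < n | (j <= x)%N) qexp (A x).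

(* The weights times [1 - s z], as linear forms in [X i = q^(A_[i+1, n])]. *)
Definition entry X (k l : nat) : K :=
  if l is l'.+1 then
    if (k < l)%N then - s * z * (X l - X l')
    else if k == l then - s * (z * X l - s * X l')
    else - s ^+ 2 * (X l - X l')
  else 1.

(* [z d/dz] of the previous entries. *)
Definition dentry X (k l : nat) : K :=
  if l is l'.+1 then
    if (k < l)%N then - s * z * (X l - X l')
    else if k == l then - s * z * X l
    else 0
  else 0.

Lemma qtlS A (x : 'I_n) : qtl A x = qexp (A x) * qtl A x.+1.
Proof.
rewrite /qtl (bigD1 x) //=; congr (_ * _); apply: eq_bigl => y.
by rewrite -val_eqE /= ltn_neqAle eq_sym andbC.
Qed.

(** Conservation, exponentiated coordinate by coordinate: color [k] counts in the tail from [j] when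
    [j < k]. *)
Lemma qtl_shift A k C l j : (k <= n)%N -> (l <= n)%N -> balanced A k C l ->
  qtl A j * q ^+ (j < k)%N = qtl C j * q ^+ (j < l)%N.
Proof.
move=> k_n l_n /balancedP bal.
have pw i : (i <= n)%N ->
    q ^+ (j < i)%N = \prod_(x < n | (j <= x)%N) q ^+ (x.+1 == i)%N.
  move=> i_n; have [ji|ij] := ltnP j i; last first.
    by rewrite big1 // => x jx; rewrite gtn_eqF // ltnS (leq_trans ij).
  case: i ji i_n => // i ji i_n.
  rewrite (bigD1 (Ordinal i_n)) //= eqxx big1 ?mulr1 // => x /andP[_].
  by rewrite -val_eqE /= eqSS => /negPf ->.
rewrite !pw // -!big_split /=; apply: eq_bigr => x _.
case: (A x) (C x) (bal x) => [a|] [c|] //=; rewrite ?mul0r // -!exprD => -[].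
by rewrite addnC => ->; rewrite addnC.
Qed.

Lemma entry_vanish A k (x : 'I_n) :
  k != x.+1 -> A x = Some 0%N -> entry (qtl A) k x.+1 = 0.
Proof.
by move=> /negPf kx Ax; rewrite /= kx qtlS Ax /= expr0 mul1r subrr !mulr0 if_same.
Qed.

Lemma dentry_vanish A k (x : 'I_n) :
  k != x.+1 -> A x = Some 0%N -> dentry (qtl A) k x.+1 = 0.
Proof.
by move=> /negPf kx Ax; rewrite /= kx qtlS Ax /= expr0 mul1r subrr !mulr0 if_same.
Qed.

(** The coefficient is [0] where the subtraction in [vnext] would be truncated, so identities
    multiplied by it may assume conservation. *)
Definition vanishing (f : (nat -> K) -> nat -> nat -> K) :=
  forall A k (x : 'I_n), k != x.+1 -> A x = Some 0%N -> f (qtl A) k x.+1 = 0.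

Lemma vanishing_balanced f A k l : vanishing f ->
  f (qtl A) k l = 0 \/ balanced A k (vnext A k l) l.
Proof.
move=> fv; have [|/forallPn[x]] :=
  boolP [forall x : 'I_n, (x.+1 == l) ==> (k != l) ==> (A x != Some 0%N)].
  move=> /forallP Apos; right; apply: balanced_vnext => x xl kl.
  by have := Apos x; rewrite xl eqxx kl.
rewrite !negb_imply => /and3P[/eqP <- kx /andP[/eqP Ax _]]; left; exact: fv.
Qed.

Lemma qtl_vnext f A k l j : vanishing f -> (k <= n)%N -> (l <= n)%N ->
  f (qtl A) k l * (qtl (vnext A k l) j * q) =
  f (qtl A) k l * (qtl A j * q ^+ (if (j < l)%N then (j < k)%N : nat else (j < k)%N.+1)).
Proof.
move=> fv k_n l_n; have [->|bal] := vanishing_balanced A k l fv; first by rewrite !mul0r.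
congr (_ * _); have := qtl_shift j k_n l_n bal.
case: (j < l)%N; rewrite ?expr0 ?expr1 ?mulr1 => h.
  by rewrite h.
by rewrite exprSr mulrA h.
Qed.

Definition two_step (f g : (nat -> K) -> nat -> nat -> K) A k1 k2 l1 l2 :=
  f (qtl A) k1 l1 * g (qtl (vnext A k1 l1)) k2 l2.

(** The generator on the outputs, minus its backward form on the inputs, minus the correction
    [(1 - q) (D L - L D)]. *)
Definition local_defect A k1 k2 l1 l2 :=
  rate q l2 l1 * two_step entry entry A k1 k2 l2 l1
  - rate q l1 l2 * two_step entry entry A k1 k2 l1 l2
  - rate q k1 k2 * (two_step entry entry A k2 k1 l1 l2
                    - two_step entry entry A k1 k2 l1 l2)
  - (1 - q) * (two_step dentry entry A k1 k2 l1 l2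
               - two_step entry dentry A k1 k2 l1 l2).

(* Expressing [qtl (vnext A k1 l1)] through [X = qtl A] may divide by [q] once; *)
(* the two definitions below are the result of clearing this denominator.      *)
Definition shifted (X : nat -> K) k1 l1 (j : nat) : K :=
  X j * q ^+ (if (j < l1)%N then (j < k1)%N : nat else (j < k1)%N.+1).

Definition qentry X (k l : nat) : K := if l is 0 then q else entry X k l.

(** For [l2 > 0] the second entry is linear in the tails, which absorb [q]; for [l2 = 0] it is the
    constant [1] and [q] itself remains, hence [qentry]. *)
Lemma two_step_entry f A k1 k2 l1 l2 : vanishing f ->
    (k1 <= n)%N -> (l1 <= n)%N ->
  q * two_step f entry A k1 k2 l1 l2 =
  f (qtl A) k1 l1 * qentry (shifted (qtl A) k1 l1) k2 l2.
Proof.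
move=> fv k_n l_n; rewrite /two_step; case: l2 => [|l2] /=; first by rewrite mulr1 mulrC.
have E0 := qtl_vnext A l2 fv k_n l_n; have E1 := qtl_vnext A l2.+1 fv k_n l_n.
rewrite /shifted.
case: (k2 < l2.+1)%N; last case: (k2 == l2.+1).
- transitivity (- s * z * (f (qtl A) k1 l1 * (qtl (vnext A k1 l1) l2.+1 * q)
     - f (qtl A) k1 l1 * (qtl (vnext A k1 l1) l2 * q))); first by ring.
  by rewrite E0 E1; ring.
- transitivity (- s * (z * (f (qtl A) k1 l1 * (qtl (vnext A k1 l1) l2.+1 * q))
     - s * (f (qtl A) k1 l1 * (qtl (vnext A k1 l1) l2 * q)))); first by ring.
  by rewrite E0 E1; ring.
transitivity (- s ^+ 2 * (f (qtl A) k1 l1 * (qtl (vnext A k1 l1) l2.+1 * q)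
     - f (qtl A) k1 l1 * (qtl (vnext A k1 l1) l2 * q))); first by ring.
by rewrite E0 E1; ring.
Qed.

Lemma two_step_dentry A k1 k2 l1 l2 : (k1 <= n)%N -> (l1 <= n)%N ->
  q * two_step entry dentry A k1 k2 l1 l2 =
  entry (qtl A) k1 l1 * dentry (shifted (qtl A) k1 l1) k2 l2.
Proof.
move=> k_n l_n; rewrite /two_step; case: l2 => [|l2] /=; first by rewrite !mulr0.
have E0 := qtl_vnext A l2 entry_vanish k_n l_n.
have E1 := qtl_vnext A l2.+1 entry_vanish k_n l_n.
set e := entry _ _ _ in E0 E1 *; rewrite /shifted.
case: (k2 < l2.+1)%N; last case: (k2 == l2.+1).
- transitivity (- s * z * (e * (qtl (vnext A k1 l1) l2.+1 * q)
     - e * (qtl (vnext A k1 l1) l2 * q))); first by ring.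
  by rewrite E0 E1; ring.
- transitivity (- s * z * (e * (qtl (vnext A k1 l1) l2.+1 * q))); first by ring.
  by rewrite E1; ring.
by rewrite !mulr0.
Qed.

Ltac split_comparisons :=
  repeat match goal with
  | |- context [leq ?a ?b] => let h := fresh in
      case h : (leq a b); rewrite ?h /=; try (exfalso; lia)
  | |- context [@eq_op _ ?a ?b] => let h := fresh in
      case h : (a == b); rewrite ?h /=; try (exfalso; lia)
  end.

(** The tails are free variables here. Only the relative order of the labels and the vanishing of
    the outputs matter, and each of these finitely many cases is a polynomial identity. *)
Lemma local_identity X k1 k2 l1 l2 :
  rate q l2 l1 * (entry X k1 l2 * qentry (shifted X k1 l2) k2 l1)
  - rate q l1 l2 * (entry X k1 l1 * qentry (shifted X k1 l1) k2 l2)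
  - rate q k1 k2 * (entry X k2 l1 * qentry (shifted X k2 l1) k1 l2
                    - entry X k1 l1 * qentry (shifted X k1 l1) k2 l2)
  - (1 - q) * (dentry X k1 l1 * qentry (shifted X k1 l1) k2 l2
               - entry X k1 l1 * dentry (shifted X k1 l1) k2 l2) = 0.
Proof.
rewrite /rate /qentry /shifted /entry /dentry.
case: (ltngtP l1 l2) => [|| <-]; case: l1 => [|l1]; try case: l2 => [|l2] //=.
all: by move=> *; split_comparisons; ring.
Qed.

Lemma local_defectM A k1 k2 l1 l2 :
  (k1 <= n)%N -> (k2 <= n)%N -> (l1 <= n)%N -> (l2 <= n)%N ->
  q * local_defect A k1 k2 l1 l2 = 0.
Proof.
move=> k1n k2n l1n l2n; rewrite -[RHS](local_identity (qtl A) k1 k2 l1 l2).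
rewrite -!(two_step_entry _ _ _ entry_vanish) //.
rewrite -!(two_step_entry _ _ _ dentry_vanish) // -two_step_dentry //.
by rewrite /local_defect; ring.
Qed.

End Entries.

(** Serves to evaluate polynomials in [q]: the defect is built by ring operations, with case
    distinctions on labels and tuples only. *)
Lemma rmorph_local_defect (K K' : comNzRingType) (phi : {rmorphism K -> K'})
    q s z A k1 k2 l1 l2 :
  phi (local_defect q s z A k1 k2 l1 l2) =
  local_defect (phi q) (phi s) (phi z) A k1 k2 l1 l2.
Proof.
have qtlE A' j : phi (qtl q A' j) = qtl (phi q) A' j.
  rewrite rmorph_prod; apply: eq_bigr => x _.
  by case: (A' x) => [a|]; rewrite /= ?rmorphXn ?rmorph0.
have entryE A' k l : phi (entry s z (qtl q A') k l) =
    entry (phi s) (phi z) (qtl (phi q) A') k l.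
  by case: l => [|l] /=; do 2?case: ifP => _;
    rewrite ?(rmorph1, rmorphM, rmorphN, rmorphB, rmorphXn, qtlE).
have dentryE A' k l : phi (dentry s z (qtl q A') k l) =
    dentry (phi s) (phi z) (qtl (phi q) A') k l.
  by case: l => [|l] /=; do 2?case: ifP => _;
    rewrite ?(rmorph0, rmorphM, rmorphN, rmorphB, rmorphXn, qtlE).
have rateE a b : phi (rate q a b) = rate (phi q) a b.
  by rewrite /rate; do 2?case: ifP => _; rewrite ?rmorph1 ?rmorph0.
by rewrite /local_defect /two_step
  !(rmorphB, rmorphM, rmorph1, rateE, entryE, dentryE).
Qed.

(* The defect is polynomial in [q]; passing through [{poly K}] makes the *)
(* division by [q] harmless, including at [q = 0].                         *)
Lemma local_defect0 (K : idomainType) (q s z : K) A k1 k2 l1 l2 :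
  (k1 <= n)%N -> (k2 <= n)%N -> (l1 <= n)%N -> (l2 <= n)%N ->
  local_defect q s z A k1 k2 l1 l2 = 0.
Proof.
move=> k1n k2n l1n l2n.
have /eqP := local_defectM 'X s%:P z%:P A k1n k2n l1n l2n.
rewrite mulf_eq0 polyX_eq0 /= => /eqP /(congr1 (horner_eval q)).
by rewrite rmorph_local_defect /= /horner_eval hornerX !hornerC.
Qed.

End LocalRelation.

(** * Null sequences and truncated sums *)

Section RealValuedNorm.
Variable R : realType.
Implicit Types x y : R[i].

(** The norm of [R[i]] takes values in [R[i]]; a copy in [R] gives a total order and suprema. *)
Definition cnorm x : R := complex.Re `|x|.

Lemma cnormE x : (cnorm x)%:C = `|x|.
Proof. by rewrite RRe_real // normr_real. Qed.

Lemma cnorm_ge0 x : 0 <= cnorm x.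
Proof. by rewrite -lecR cnormE rmorph0 normr_ge0. Qed.

Lemma cnorm_eq0 x : (cnorm x == 0) = (x == 0).
Proof. by rewrite -(inj_eq (@complexI R)) cnormE rmorph0 normr_eq0. Qed.

Lemma cnorm0 : cnorm 0 = 0.
Proof. by apply/eqP; rewrite cnorm_eq0. Qed.

Lemma cnormM x y : cnorm (x * y) = cnorm x * cnorm y.
Proof. by apply: complexI; rewrite rmorphM /= !cnormE normrM. Qed.

Lemma cnormN x : cnorm (- x) = cnorm x.
Proof. by rewrite /cnorm normrN. Qed.

Lemma cnormD x y : cnorm (x + y) <= cnorm x + cnorm y.
Proof. by rewrite -lecR rmorphD /= !cnormE ler_normD. Qed.

Lemma cnormR (a : R) : cnorm a%:C = `|a|.
Proof. by rewrite /cnorm normc_def /= expr0n addr0 sqrtr_sqr. Qed.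

Lemma cnorm1 : cnorm 1 = 1.
Proof. by rewrite /cnorm normr1. Qed.

Lemma cnorm_prod (I : finType) (F : I -> R[i]) :
  cnorm (\prod_i F i) = \prod_i cnorm (F i).
Proof. by apply: (big_morph cnorm cnormM cnorm1). Qed.

Lemma cnorm_sum (I : finType) (P : pred I) (F : I -> R[i]) :
  cnorm (\sum_(i | P i) F i) <= \sum_(i | P i) cnorm (F i).
Proof.
elim/big_ind2: _ => [|x a y b xa yb|//]; first by rewrite cnorm0.
by apply: le_trans (cnormD _ _) _; apply: lerD.
Qed.

Implicit Types u v : nat -> R[i].

Definition null u := forall e : R, 0 < e ->
  exists K0, forall K, (K0 <= K)%N -> cnorm (u K) <= e.

Definition bounded_seq u := exists c : R, forall K, cnorm (u K) <= c.

Lemma null0 : null (fun=> 0).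
Proof. by move=> e e0; exists 0%N => K _; rewrite cnorm0 ltW. Qed.

Lemma nullD u v : null u -> null v -> null (fun K => u K + v K).
Proof.
move=> nu nv e e0; have e2 : 0 < e / 2 by rewrite divr_gt0.
have [[K1 h1] [K2 h2]] := (nu _ e2, nv _ e2).
exists (maxn K1 K2) => K; rewrite geq_max => /andP[k1 k2].
by rewrite (le_trans (cnormD _ _)) // [leRHS]splitr lerD // ?h1 ?h2.
Qed.

Lemma null_sum (I : finType) (P : pred I) (u_ : I -> nat -> R[i]) :
  (forall i, P i -> null (u_ i)) -> null (fun K => \sum_(i | P i) u_ i K).
Proof.
move=> nu.
have -> : (fun K => \sum_(i | P i) u_ i K) = (\sum_(i | P i) u_ i)%R :> (nat -> R[i]).
  by apply/funext => K; rewrite fct_sumE.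
elim/big_ind: _ => [|u v|//]; [exact: null0|exact: nullD].
Qed.

Lemma null_bounded u v : bounded_seq u -> null v -> null (fun K => u K * v K).
Proof.
move=> [c uc] nv e e0.
have c0 : 0 <= c by apply: le_trans (uc 0%N); exact: cnorm_ge0.
have c1 : 0 < c + 1 by rewrite ltr_wpDl.
have [K0 h] := nv (e / (c + 1)) (divr_gt0 e0 c1); exists K0 => K /h vK.
rewrite cnormM (le_trans (ler_pM (cnorm_ge0 _) (cnorm_ge0 _) (uc K) vK)) //.
by rewrite mulrCA ler_piMr ?ltW // ltr_pdivrMr // mul1r ltrDl.
Qed.

Lemma nullZ (c : R[i]) u : null u -> null (fun K => c * u K).
Proof. by apply: null_bounded; exists (cnorm c). Qed.

Lemma null_le u (d : nat -> R) :
  (forall e : R, 0 < e -> exists K0, forall K, (K0 <= K)%N -> d K <= e) ->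
  (forall K, cnorm (u K) <= d K) -> null u.
Proof.
by move=> nd ud e /nd[K0 h]; exists K0 => K /h; apply: le_trans (ud K).
Qed.

Lemma null_const (x : R[i]) : null (fun=> x) -> x = 0.
Proof.
move=> nx; apply/eqP; rewrite -cnorm_eq0; apply: contraT => x0.
have xp : 0 < cnorm x by rewrite lt_def x0 cnorm_ge0.
have [K0 /(_ K0 (leqnn _))] := nx _ (divr_gt0 xp (ltr0Sn R 1)).
lra.
Qed.

Lemma bounded_seq_sum (I : finType) (u_ : I -> nat -> R[i]) :
  (forall i, bounded_seq (u_ i)) -> bounded_seq (fun K => \sum_i u_ i K).
Proof.
move=> /choice[c uc]; exists (\sum_i c i) => K.
by rewrite (le_trans (cnorm_sum _ _)) // ler_sum.
Qed.

Lemma bounded_seqM u v : bounded_seq u -> bounded_seq v ->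
  bounded_seq (fun K => u K * v K).
Proof.
move=> [c uc] [d vd]; exists (c * d) => K.
by rewrite cnormM ler_pM // cnorm_ge0.
Qed.

(** From some index on, [b] stays within [e] of its supremum. *)
Lemma increments_to0 (b : nat -> R) (c : R) : (forall K, b K <= b K.+1) ->
  (forall K, b K <= c) ->
  forall e : R, 0 < e -> exists K0, forall K, (K0 <= K)%N -> b K.+1 - b K <= e.
Proof.
move=> bS bc e e0; pose E : set R := range b.
have sE : has_sup E.
  by split; [exists (b 0%N), 0%N|exists c => _ [K _ <-]].
have [_ [K0 _ <-] K0e] := sup_adherent e0 sE; exists K0 => K K0K.
have bmono : b K0 <= b K.
  by rewrite -(subnKC K0K); elim: (K - K0)%N => [|d IH];
    rewrite ?addn0 // addnS (le_trans IH).
have : b K.+1 <= sup E by apply: sup_upper_bound => //; exists K.+1.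
lra.
Qed.

End RealValuedNorm.

(** * Finite boxes of vertical tuples *)

Section Boxes.
Variable n : nat.
Implicit Types A C : vtuple n.

Definition box (K : nat) := {ffun 'I_n -> option 'I_K.+1}.

Definition unbox K (a : box K) : vtuple n := [ffun x => omap val (a x)].

Lemma unbox_inj K : injective (@unbox K).
Proof.
move=> a b /ffunP ab; apply/ffunP => x; have := ab x; rewrite !ffunE.
by case: (a x) (b x) => [i|] [j|] //= [/val_inj ->].
Qed.

Definition in_box K A : bool :=
  [forall x : 'I_n, if A x is Some a then (a <= K)%N else true].

Lemma unbox_in K (a : box K) : in_box K (unbox a).
Proof. by apply/forallP => x; rewrite ffunE; case: (a x) => //= i; rewrite -ltnS. Qed.

Lemma in_boxP K A : reflect (exists a : box K, A = unbox a) (in_box K A).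
Proof.
apply: (iffP idP) => [/forallP Ain|[a ->]]; last exact: unbox_in.
exists [ffun x => omap inord (A x)]; apply/ffunP => x; rewrite !ffunE.
by case: (A x) (Ain x) => //= a aK; rewrite inordK.
Qed.

Lemma in_boxW K K' A : (K <= K')%N -> in_box K A -> in_box K' A.
Proof.
move=> KK' /forallP Ain; apply/forallP => x; have := Ain x.
by case: (A x) => // a /leq_trans; apply.
Qed.

Lemma in_box_vnext K A k l : in_box K A -> in_box K.+1 (vnext A k l).
Proof.
move=> /forallP Ain; apply/forallP => x; rewrite ffunE; have := Ain x.
case: (A x) => //= a aK; apply: leq_trans (leq_subr _ _) _.
exact: (leq_add (leq_b1 _) aK).
Qed.

Section Paths.
Variable N : nat.

Definition boxed_path K := {ffun 'I_N -> box K}.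
Definition unbox_path K (A : boxed_path K) : {ffun 'I_N -> vtuple n} :=
  [ffun j => unbox (A j)].
Definition path_in_box K (A : {ffun 'I_N -> vtuple n}) : bool :=
  [forall j, in_box K (A j)].

Lemma unbox_path_inj K : injective (@unbox_path K).
Proof.
move=> A B /ffunP AB; apply/ffunP => j.
by apply: unbox_inj; have := AB j; rewrite !ffunE.
Qed.

Lemma path_in_boxP K (A : {ffun 'I_N -> vtuple n}) :
  reflect (exists a : boxed_path K, A = unbox_path a) (path_in_box K A).
Proof.
apply: (iffP forallP) => [Ain|[a ->] j]; last by rewrite ffunE unbox_in.
have /choice[a aE] : forall j, exists b : box K, A j = unbox b.
  by move=> j; apply/in_boxP.
by exists (finfun a); apply/ffunP => j; rewrite !ffunE.
Qed.

Lemma sum_boxed_path (V : nmodType) K K' (f : {ffun 'I_N -> vtuple n} -> V) :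
  (K <= K')%N ->
  \sum_(A : boxed_path K' | path_in_box K (unbox_path A)) f (unbox_path A) =
  \sum_(A : boxed_path K) f (unbox_path A).
Proof.
move=> KK'; rewrite -(big_image _ _ (@unbox_path K'))
  -(big_image _ _ (@unbox_path K) predT).
apply: perm_big; apply: uniq_perm.
- by rewrite map_inj_uniq ?enum_uniq //; apply: unbox_path_inj.
- by rewrite map_inj_uniq ?enum_uniq //; apply: unbox_path_inj.
move=> A; apply/mapP/mapP => [[a]|[a _ ->]]; rewrite ?mem_enum.
  by move=> /path_in_boxP[b ab] ->; exists b; rewrite ?mem_enum.
have : path_in_box K' (unbox_path a).
  by apply/forallP => j; rewrite ffunE; apply: in_boxW KK' (unbox_in _).
move=> /path_in_boxP[b ab]; exists b => //; rewrite mem_enum.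
by apply/path_in_boxP; exists a.
Qed.

End Paths.
End Boxes.

Section FiniteSums.
Variables (I V : finType) (S : nmodType).

Definition update (A : {ffun I -> V}) (i : I) (b : V) : {ffun I -> V} :=
  [ffun j => if j == i then b else A j].

(** Functions are grouped by their values off [i]; each group is traversed by [update] at [i], and
    there [G] sums to [0]. *)
Lemma sum_update0 (i : I) (P : pred {ffun I -> V}) (G : {ffun I -> V} -> S) :
  (forall A b, P (update A i b) = P A) ->
  (forall A, P A -> \sum_b G (update A i b) = 0) ->
  \sum_(A | P A) G A = 0.
Proof.
move=> Pupd G0.
have [v0 _|V0] := pickP V; last first.
  by rewrite big1 // => A; have := V0 (A i).
rewrite (partition_big (fun A => update A i v0) predT) //= big1 // => B _.
have [PB|nPB] := boolP (P B && (B i == v0)); last first.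
  rewrite big1 // => A /andP[PA /eqP AB]; move: nPB.
  by rewrite -AB Pupd PA ffunE eqxx eqxx.
have [{}PB /eqP Bi] := andP PB; rewrite -[RHS](G0 B PB).
rewrite (reindex_onto (update B i) (fun A => A i)) /=.
  apply: eq_bigl => b; rewrite Pupd PB ffunE eqxx eqxx andbT /=.
  by apply/eqP/ffunP => j; rewrite !ffunE; case: eqP => // ->.
move=> A /andP[_ /eqP <-]; apply/ffunP => j; rewrite !ffunE.
by case: eqP => // ->.
Qed.

End FiniteSums.

(** * Transfer operators of the columns *)

Section Column.
Variables (R : realType) (n : nat) (q : R) (s z : R[i]) (m : 'I_n).
Hypothesis q01 : 0 <= q < 1.
Implicit Types (A B C : vtuple n) (k l : nat).

Let q0 : 0 <= q. Proof. by case/andP: q01. Qed.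
Let q1 : q < 1. Proof. by case/andP: q01. Qed.

Definition adm A : bool :=
  [forall i : 'I_n, if (i < m)%N then A i == Some 0%N
                    else if i == m then A i == None else A i != None].

Definition enterable k : bool := (k == 0)%N || (m.+1 < k)%N.

Definition kind (hat : bool) := if hat then dentry s z else entry s z.

(** [adm] is tested at the bottom only, as conservation passes it on to [C]. The prefactor is not
    differentiated: its derivative would add the same multiple of [L L] to both correction terms and
    cancel. *)
Definition vweight (hat : bool) A k C l : R[i] :=
  if [&& adm A, enterable k & balanced A k C l]
  then (1 - s * z)^-1 * kind hat (qtl q%:C A) k l else 0.

Lemma kind_vanishing hat : vanishing n q%:C (kind hat).
Proof. by case: hat; [apply: dentry_vanish|apply: entry_vanish]. Qed.

Lemma adm_lt A (i : 'I_n) : adm A -> (i < m)%N -> A i = Some 0%N.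
Proof. by move=> /forallP/(_ i) + im; rewrite im => /eqP. Qed.

Lemma adm_m A : adm A -> A m = None.
Proof. by move=> /forallP/(_ m); rewrite ltnn eqxx => /eqP. Qed.

Lemma adm_gt A (i : 'I_n) : adm A -> (m < i)%N -> A i != None.
Proof.
by move=> /forallP/(_ i) + im; rewrite ltnNge (ltnW im) /= -val_eqE /= gtn_eqF.
Qed.

Lemma balanced_adm A k C l : adm A -> enterable k -> balanced A k C l -> adm C.
Proof.
move=> aA ek /balancedP bal; apply/forallP => i; have := bal i.
have [im|mi|/val_inj ->] := ltngtP i m.
- rewrite (adm_lt aA im).
  have -> : (i.+1 == k) = false.
    by case/orP: ek => [/eqP ->|mk] //; apply/ltn_eqF/(ltn_trans _ mk).
  case: (C i) => [c|] //=; case: (_ == l) => //= -[] //.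
  by rewrite !add0n => <-.
- have -> : (i == m) = false by apply: contraTF mi => /eqP ->; rewrite ltnn.
  by have := adm_gt aA mi; case: (A i) (C i) => [a|] [c|].
- by rewrite eqxx (adm_m aA); case: (C m) => //=.
Qed.

Lemma qtl_m A j : adm A -> (j <= m)%N -> qtl q%:C A j = 0.
Proof. by move=> aA jm; rewrite /qtl (bigD1 m) //= (adm_m aA) mul0r. Qed.

Lemma qtl_qtail A (i : 'I_n) : qtail q A i = qtl q%:C A i.+1.
Proof.
by apply: eq_bigr => x _; case: (A x) => [a|] //=; rewrite rmorphXn.
Qed.

Lemma qtlR A j : qtl q%:C A j = (qtl q A j)%:C.
Proof.
rewrite rmorph_prod; apply: eq_bigr => x _.
by case: (A x) => [a|] //=; rewrite ?rmorphXn ?rmorph0.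
Qed.

Lemma qtl_ge0 A j : 0 <= qtl q A j.
Proof. by apply: prodr_ge0 => x _; case: (A x) => //= a; apply: exprn_ge0. Qed.

Lemma qtl_le1 A j : qtl q A j <= 1.
Proof.
apply: prodr_ile1 => x _; case: (A x) => /= [a|]; last by rewrite lexx ler01.
by rewrite exprn_ge0 // exprn_ile1 // ltW.
Qed.

Lemma eq_ordS (x k : 'I_n) : (x.+1 == k.+1)%N = (x == k).
Proof. by rewrite eqSS. Qed.

Lemma balanced_incr A (k : 'I_n) C : balanced A k.+1 C 0 = (C == incr A k).
Proof.
apply/balancedP/eqP => [bal|-> x]; last first.
  rewrite ffunE eq_ordS /=.
  by case: eqP; case: (A x).
apply/ffunP => x; have := bal x; rewrite ffunE eq_ordS /=.
by case: eqP; case: (A x) (C x) => [a|] [c|].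
Qed.

Lemma balanced00 A C : balanced A 0 C 0 = (C == A).
Proof.
apply/balancedP/eqP => [bal|-> //]; apply/ffunP => x.
exact/esym/(oadd_inj (bal x)).
Qed.

Lemma balanced_decr A C (l : 'I_n) : A l != Some 0%N ->
  balanced A 0 C l.+1 = (C == decr A l).
Proof.
move=> Al; apply/balancedP/eqP => [bal|-> x]; last first.
  rewrite ffunE eq_ordS /=.
  by case: (eqVneq x l) => [->|]; [case: (A l) Al => [[]|]|case: (A x)].
apply/ffunP => x; have := bal x; rewrite ffunE eq_ordS /=.
case: (eqVneq x l) => [->|]; last by case: (A x) (C x) => [a|] [c|].
by case: (A l) (C l) Al => [[|a]|] [c|] // _ [->].
Qed.

Lemma balanced_infty A C (l : 'I_n) : A l = None ->
  balanced A 0 C l.+1 = (C == A).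
Proof.
move=> Al; rewrite balanced_decr ?Al //; congr (_ == _).
by apply/ffunP => x; rewrite ffunE; case: eqP => // ->; rewrite Al.
Qed.

Lemma balanced_assoc A (k : 'I_n) C l :
  balanced A k.+1 C l = balanced (incr A k) 0 C l.
Proof.
have /balancedP bal : balanced A k.+1 (incr A k) 0 by rewrite balanced_incr.
by apply: eq_forallb => x; rewrite bal.
Qed.

(** Consecutive tails differ by [(1 - q^(A_l)) q^(A_[l+1, n])]. For an exit below color [m] both
    tails are [0]; for color [m] the subtracted one is. *)
Lemma queue_weight_vweight A (k : 'I_n.+1) C (l : 'I_n.+1) : adm A ->
  queue_weight q s z m A k C l = vweight false A k C l.
Proof.
move=> aA; rewrite /vweight aA /=.
have qexpE o : qpow q o = qexp q%:C o :> R[i].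
  by case: o => //= a; rewrite rmorphXn.
have XlE (x : 'I_n) : qtl q%:C A x.+1 - qtl q%:C A x =
    (1 - qpow q (A x)) * qtail q A x.
  by rewrite qtlS qexpE qtl_qtail; ring.
have XlmE (x : 'I_n) : (x < m)%N -> qtl q%:C A x.+1 - qtl q%:C A x = 0.
  by move=> xm; rewrite !qtl_m ?subrr // ltnW.
have [M MS] : exists M, M = m.+1 by exists m.+1.
rewrite /queue_weight; case: unliftP => [k' ->|->]; case: unliftP => [l' ->|->].
- rewrite /enterable !lift0 /= ltnS eqSS balanced_assoc.
  have [mk|km] := ltnP m k'; last by rewrite mulr0.
  rewrite ltnS -!val_eqE /=.
  have [lm|ml|lm] := ltngtP l' m.
  + have lk := ltn_trans lm mk.
    rewrite XlmE // (ltn_eqF lk) (gtn_eqF lk) [(k' < l')%N]ltnNge (ltnW lk) /=.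
    by rewrite !mulr0 if_same.
  + rewrite [(l' == k' :> nat)]eq_sym.
    have decr0 : k' != l' :> nat -> A l' != Some 0%N ->
        balanced (incr A k') 0 C l'.+1 = (C == decr (incr A k') l').
      move=> kl Al; apply: balanced_decr; rewrite ffunE ifN //.
      by apply: contra kl => /eqP ->.
    have [kl|lk|/val_inj kl] := ltngtP k' l'.
    (* At an empty [A l'] truncated decrement and conservation disagree, but both weights contain
       the factor [1 - q^0]. *)
    * have [Al|Al] := eqVneq (A l') (Some 0%N).
        by rewrite XlE Al /= expr0 subrr mul0r !mulr0 !mul0r !if_same mulr0.
      rewrite decr0 ?ltn_eqF // XlE /=; case: ifP => _; last by rewrite mulr0.
      by rewrite !mulrA.
    * have [Al|Al] := eqVneq (A l') (Some 0%N).
        by rewrite XlE Al /= expr0 subrr mul0r !mulr0 !mul0r !if_same mulr0.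
      rewrite decr0 ?gtn_eqF // XlE /=; case: ifP => _; last by rewrite mulr0.
      by rewrite !mulrA.
    * rewrite kl /= in mk *.
      rewrite balanced_decr; last by rewrite ffunE eqxx; case: (A l').
      have -> : decr (incr A l') l' = A.
        by apply/ffunP => x; rewrite !ffunE; case: eqP => // ->; case: (A l').
      case: ifP => _; last by rewrite mulr0.
      by rewrite qtlS qexpE qtl_qtail; ring.
  + have {lm}-> : l' = m by apply: val_inj.
    rewrite balanced_infty; last first.
      by rewrite ffunE -val_eqE ltn_eqF // adm_m.
    rewrite ltn_eqF // [(k' < m)%N]ltnNge (ltnW mk) /= gtn_eqF //.
    case: ifP => _; last by rewrite mulr0.
    by rewrite XlE adm_m //= subr0 mul1r.
- rewrite /enterable lift0 /= ltnS balanced_incr.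
  by case: ifP => _; rewrite ?mulr1 ?mulr0.
- rewrite /enterable lift0 -val_eqE /=.
  have [lm|ml|lm] := ltngtP l' m.
  + by rewrite XlmE // !mulr0 if_same.
  + have [Al|Al] := eqVneq (A l') (Some 0%N).
      by rewrite XlE Al /= expr0 subrr mul0r !mulr0 !mul0r !if_same mulr0.
    rewrite balanced_decr // XlE /=; case: ifP => _; last by rewrite mulr0.
    by rewrite !mulrA.
  + have {lm}-> : l' = m by apply: val_inj.
    rewrite balanced_infty ?adm_m // XlE adm_m // subr0 mul1r.
    by rewrite /=; case: ifP => _; rewrite ?mulr0.
- by rewrite /enterable /= balanced00 mulr1; case: ifP => _; rewrite ?mulr1 ?mulr0.
Qed.

(** Conservation leaves a single middle tuple, [vnext A k1 l1], whose entries exceed those of [A] by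
    at most one; hence the box [K.+1]. *)
Lemma sum_two_site hat hat' K A k1 k2 C l1 l2 : in_box K A ->
  \sum_(b : box n K.+1) vweight hat A k1 (unbox b) l1 * vweight hat' (unbox b) k2 C l2
  = if [&& adm A, enterable k1, enterable k2 & balanced2 A k1 k2 C l1 l2]
    then (1 - s * z)^-1 ^+ 2 * two_step q%:C (kind hat) (kind hat') A k1 k2 l1 l2
    else 0.
Proof.
move=> AK; rewrite /vweight /two_step.
have [aA|_] := boolP (adm A); last by rewrite big1 // => b _; rewrite mul0r.
have [e1|_] := boolP (enterable k1); last by rewrite big1 // => b _; rewrite mul0r.
have [->|bal] := vanishing_balanced A k1 l1 (kind_vanishing hat).
  by rewrite mul0r !mulr0 if_same big1 // => b _; rewrite if_same mul0r.
have /in_boxP[b0 b0E] := in_box_vnext k1 l1 AK; rewrite b0E in bal *.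
rewrite (bigD1 b0) //= bal (balanced_adm aA e1 bal) (balanced_comp _ _ _ bal) /=.
rewrite big1 ?addr0 => [|b bb0].
  by case: ifP => _; rewrite ?mulr0 //; ring.
case: ifP => [bal'|]; last by rewrite mul0r.
by rewrite (unbox_inj (balanced_fun bal bal')) eqxx in bb0.
Qed.

Lemma local_relation K A C k1 k2 l1 l2 : in_box K A ->
  (k1 <= n)%N -> (k2 <= n)%N -> (l1 <= n)%N -> (l2 <= n)%N ->
  let S hat hat' k1 k2 l1 l2 := \sum_(b : box n K.+1)
    vweight hat A k1 (unbox b) l1 * vweight hat' (unbox b) k2 C l2 in
  rate q%:C l2 l1 * S false false k1 k2 l2 l1
  - rate q%:C l1 l2 * S false false k1 k2 l1 l2
  - rate q%:C k1 k2 * (S false false k2 k1 l1 l2 - S false false k1 k2 l1 l2)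
  - (1 - q%:C) * (S true false k1 k2 l1 l2 - S false true k1 k2 l1 l2) = 0.
Proof.
move=> AK k1n k2n l1n l2n /=; rewrite !sum_two_site //.
(* The guard is symmetric in inputs and in outputs, hence common to all terms. *)
rewrite (balanced2Cr _ _ _ _ l2) (balanced2Cl _ k2) (andbCA (enterable k2)).
case: ifP => _; last by rewrite !mulr0 subrr !mulr0 !subr0.
transitivity ((1 - s * z)^-1 ^+ 2 * local_defect q%:C s z A k1 k2 l1 l2).
  by rewrite /local_defect; ring.
by rewrite local_defect0 ?mulr0.
Qed.

(* The weight of a site where color [m] exits is at most a multiple of [exit_mass], *)
(* whose sum over all tuples converges.                                            *)
Definition exit_mass A : R := if adm A then qtl q A m.+1 else 0.

Lemma exit_mass_ge0 A : 0 <= exit_mass A.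
Proof. by rewrite /exit_mass; case: ifP => // _; apply: qtl_ge0. Qed.

Lemma vweight_bound : exists2 c : R, 0 <= c & forall hat A k C l,
  cnorm (vweight hat A k C l) <=
  if balanced A k C l then c * (if l == m.+1 then exit_mass A else 1) else 0.
Proof.
pose c1 := cnorm (s * z) + cnorm (s ^+ 2).
pose c2 := cnorm (1 - s * z)^-1.
have [sz0 ss0 c20] : [/\ 0 <= cnorm (s * z), 0 <= cnorm (s ^+ 2) & 0 <= c2].
  by split; apply: cnorm_ge0.
have Xn A j : cnorm (qtl q%:C A j) = qtl q A j.
  by rewrite qtlR cnormR ger0_norm ?qtl_ge0.
exists (c2 * (1 + 2 * c1)) => [|hat A k C l].
  by rewrite mulr_ge0 // addr_ge0 // mulr_ge0 // addr_ge0.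
rewrite /vweight /exit_mass.
have [bal|_] := boolP (balanced A k C l); last by rewrite !andbF cnorm0.
have [aA|_] := boolP (adm A); last first.
  by rewrite cnorm0; case: ifP => _; rewrite ?mulr0 // mulr1 !(mulr_ge0, addr_ge0).
have [ek|_] := boolP (enterable k); last first.
  rewrite cnorm0 mulr_ge0 ?mulr_ge0 ?addr_ge0 ?mulr_ge0 ?addr_ge0 //.
  by case: ifP => // _; apply: qtl_ge0.
rewrite cnormM -/c2 -mulrA; apply: ler_wpM2l => //.
have Y0 j := qtl_ge0 A j; have Y1 j := qtl_le1 A j.
have [->|lm] := eqVneq l m.+1.
  (* Color [m] cannot enter, so its exit is never a diagonal entry. *)
  have [km|mk] := eqVneq k m.+1; first by move: ek; rewrite km /enterable ltnn.
  have Xm : qtl q%:C A m = 0 by apply: qtl_m.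
  have := Y0 m.+1; set y := qtl q A m.+1.
  have yE : cnorm (qtl q%:C A m.+1) = y by rewrite Xn.
  case: hat => /=; rewrite (negPf mk) Xm subr0; case: ifP => _;
    rewrite ?cnorm0 ?mulNr ?cnormN ?(cnormM _ (qtl _ _ _)) ?yE // => y0; rewrite /c1; nra.
rewrite mulr1 /c1.
case: l {lm bal} => [|l]; first by case: hat; rewrite /= ?cnorm0 ?cnorm1; nra.
have dX0 := cnorm_ge0 (qtl q%:C A l.+1 - qtl q%:C A l).
have dX1 : cnorm (qtl q%:C A l.+1 - qtl q%:C A l) <= 1.
  rewrite !qtlR -rmorphB cnormR ler_norml.
  by move: (Y0 l) (Y0 l.+1) (Y1 l) (Y1 l.+1) => *; apply/andP; split; lra.
move: (Y0 l) (Y0 l.+1) (Y1 l) (Y1 l.+1); rewrite -!Xn => x0 y0 x1 y1.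
case: hat => /=; do 2?case: ifP => _.
- by rewrite !mulNr cnormN (cnormM (s * z)); apply: le_trans (ler_piMr sz0 dX1) _; lra.
- by rewrite !mulNr cnormN (cnormM (s * z)); apply: le_trans (ler_piMr sz0 y1) _; lra.
- by rewrite cnorm0; lra.
- by rewrite !mulNr cnormN (cnormM (s * z)); apply: le_trans (ler_piMr sz0 dX1) _; lra.
- rewrite mulrBr !mulNr opprK !mulrA -expr2.
  apply: le_trans (cnormD _ _) _; rewrite cnormN !(cnormM _ (qtl _ _ _)).
  by apply: le_trans (lerD (ler_piMr sz0 y1) (ler_piMr ss0 x1)) _; lra.
- by rewrite !mulNr cnormN (cnormM (s ^+ 2)); apply: le_trans (ler_piMr ss0 dX1) _; lra.
Qed.

End Column.

Lemma iter_ordS N (j : 'I_N) t : iter t (@ordS N) j = ((j + t) %% N)%N :> nat.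
Proof.
elim: t => [|t IH] /=; first by rewrite addn0 modn_small.
by rewrite IH -addn1 modnDml addn1 addnS.
Qed.

Lemma ordS_connected N (i j : 'I_N) : exists t, j = iter t (@ordS N) i.
Proof.
exists (N - i + j)%N; apply/val_inj/esym; rewrite [LHS]iter_ordS addnA subnKC; last exact/ltnW.
by rewrite modnDl modn_small.
Qed.

Lemma ordS_neq N (j : 'I_N) : (1 < N)%N -> ordS j != j.
Proof.
move=> N1; rewrite -val_eqE /=; have := ltn_ord j.
rewrite leq_eqVlt => /orP[/eqP jN|jN]; first by rewrite jN modnn; lia.
by rewrite modn_small //; lia.
Qed.

Lemma sum_option (S : nmodType) (T : finType) (x0 : T) (F : option T -> S) :
  \sum_o F o = F None + \sum_(t : T) F (Some t).
Proof.
rewrite (bigD1 None) //=; congr (_ + _).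
rewrite (reindex_onto (@Some T) (odflt x0)) /=; last by case.
by apply: eq_bigl => t; rewrite eqxx.
Qed.

(** * Truncated traces and their intertwining relation *)

Section ColumnTrace.
Variables (R : realType) (n N : nat) (q : R) (s z : R[i]) (m : 'I_n).
Hypothesis q01 : 0 <= q < 1.
Hypothesis N1 : (1 < N)%N.
Implicit Types (A : {ffun 'I_N -> vtuple n}) (h eta : state n N).

Let q0 : 0 <= q. Proof. by case/andP: q01. Qed.
Let q1 : q < 1. Proof. by case/andP: q01. Qed.

Lemma eq_color (a : 'I_n.+1) (c : 'I_n) : (a == color c) = (c.+1 == a :> nat).
Proof. by rewrite eq_sym -val_eqE /= /bump leq0n. Qed.

Definition has_color (c : 'I_n) eta := [exists j, eta j == color c].

Lemma has_color_swap c k eta : has_color c (swap_sites k eta) = has_color c eta.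
Proof.
have im xi : has_color c xi -> has_color c (swap_sites k xi).
  move=> /existsP[j cj]; apply/existsP; exists (tperm k (ordS k) j).
  by rewrite ffunE tpermK.
by apply/idP/idP => [/im|/im//]; rewrite swap_sitesK.
Qed.

(** [hat] marks the sites that carry [D] instead of [L]. *)
Definition pweight (hat : pred 'I_N) h eta A : R[i] :=
  \prod_(j < N) vweight q s z m (hat j) (A j) (h j) (A (ordS j)) (eta j).

Definition path_mass h eta (j0 : 'I_N) A : R :=
  if [forall j, balanced (A j) (h j) (A (ordS j)) (eta j)]
  then exit_mass q m (A j0) else 0.

Lemma path_mass_ge0 h eta j0 A : 0 <= path_mass h eta j0 A.
Proof. by rewrite /path_mass; case: ifP => // _; apply: exit_mass_ge0. Qed.

(** One decaying factor is kept, at a site [j0] where color [m] exits; every other factor is bounded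
    by the constant [c]. *)
Lemma pweight_bound : exists2 c : R, 0 <= c & forall hat h eta j0 A,
  eta j0 = color m -> cnorm (pweight hat h eta A) <= c * path_mass h eta j0 A.
Proof.
have [c c0 cP] := vweight_bound s z m q01; exists (c ^+ N).
  by rewrite exprn_ge0.
move=> hat h eta j0 A etam; rewrite /pweight cnorm_prod /path_mass.
case: ifP => [/forallP bal|/negbT /forallPn[j nbal]]; last first.
  rewrite mulr0 (bigD1 j) //=.
  have := cP (hat j) (A j) (h j) (A (ordS j)) (eta j).
  rewrite (negPf nbal) => le0.
  have -> : cnorm (vweight q s z m (hat j) (A j) (h j) (A (ordS j)) (eta j)) = 0.
    by apply/le_anti; rewrite le0 cnorm_ge0.
  by rewrite mul0r.
have -> : c ^+ N * exit_mass q m (A j0) =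
    \prod_(j < N) (c * (if j == j0 then exit_mass q m (A j) else 1)).
  rewrite big_split prodr_const card_ord /= -big_mkcond big_pred1_eq //.
apply: ler_prod => j _; rewrite cnorm_ge0 /=.
apply: le_trans (cP _ _ _ _ _) _; rewrite bal; apply: ler_wpM2l => //.
case: eqP => [ej|nej]; case: eqP => [jj|njj] //.
- by rewrite /exit_mass; case: ifP => _; rewrite ?ler01 ?qtl_le1.
- by case: nej; rewrite jj etam lift0.
Qed.

(** A product over coordinates dominates the mass: those up to [m] are forced and contribute [1],
    the later ones a partial geometric series, below [1 / (1 - q)] for every [K]. *)
Lemma sum_exit_mass K :
  \sum_(a : box n K) exit_mass q m (unbox a) <= ((1 - q)^-1) ^+ n.
Proof.
pose phi (x : 'I_n) (o : option 'I_K.+1) : R :=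
  if (x < m)%N then (o == Some ord0)%:R else
  if x == m then (o == None)%:R else if o is Some b then q ^+ b else 0.
have phi0 x o : 0 <= phi x o.
  by rewrite /phi; do 2?case: ifP => // _; case: o => // b; rewrite exprn_ge0.
apply: (@le_trans _ _ (\sum_(a : box n K) \prod_x phi x (a x))).
  apply: ler_sum => a _; rewrite /exit_mass; case: ifP => [aA|_]; last first.
    by apply: prodr_ge0.
  rewrite /qtl big_mkcond /=; apply: ler_prod => x _.
  have := forallP aA x; rewrite /phi ffunE.
  have [xm|mx|/val_inj ->] := ltngtP x m.
  - case: (a x) => [b|] //= /eqP[b0]; have -> : b = ord0 by apply/val_inj.
    by rewrite eqxx ler01 lexx.
  - have -> : (x == m) = false by apply: contraTF mx => /eqP ->; rewrite ltnn.
    by case: (a x) => //= b _; rewrite exprn_ge0 ?lexx.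
  - by rewrite eqxx; case: (a m) => /= [b|] // _; rewrite ler01 lexx.
rewrite -bigA_distr_bigA -[X in _ <= _ ^+ X]card_ord -prodr_const.
have p1 : 0 < 1 - q by rewrite subr_gt0.
have le1 : 1 <= (1 - q)^-1 by rewrite invf_ge1 // gerBl.
apply: ler_prod => x _; rewrite sumr_ge0 //=.
rewrite (sum_option ord0) /phi; do 2?case: ifP => _.
- rewrite (bigD1 ord0) //= big1 ?addr0 ?add0r ?eqxx // => i /negPf i0.
  by rewrite -[nat_of_bool _]/(nat_of_bool (i == ord0)) i0.
- by rewrite big1 ?addr0 ?eqxx.
rewrite add0r -[leRHS]mul1r ler_pdivlMr // mulrC -opprB mulNr -subrX1 opprB.
by rewrite gerBl exprn_ge0.
Qed.

(** Going around the ring, conservation determines a path from its tuple at [j0], so the sum over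
    paths is at most the sum over that tuple. *)
Lemma sum_path_mass K h eta j0 :
  \sum_(A : boxed_path n N K) path_mass h eta j0 (unbox_path A)
  <= ((1 - q)^-1) ^+ n.
Proof.
apply: le_trans (sum_exit_mass K).
rewrite (partition_big (fun A : boxed_path n N K => A j0) predT) //=.
apply: ler_sum => a _.
pose bal (A : boxed_path n N K) := [forall j, balanced (unbox_path A j) (h j)
  (unbox_path A (ordS j)) (eta j)].
have uniq_path (A B : boxed_path n N K) : bal A -> bal B -> A j0 = B j0 -> A = B.
  move=> /forallP bA /forallP bB AB; apply/ffunP => j.
  have [t ->] := ordS_connected j0 j; elim: t => [//|t IH] /=.
  apply: unbox_inj; have := bA (iter t (@ordS N) j0).
  have := bB (iter t (@ordS N) j0); rewrite !ffunE -IH.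
  by move=> b1 b2; apply: balanced_fun b2 b1.
have [A0 /andP[bA0 /eqP A0a]|noA] :=
  pickP (fun A : boxed_path n N K => bal A && (A j0 == a)).
  rewrite (bigD1 A0) ?A0a //= big1 ?addr0 => [|A /andP[/eqP Aa AA0]].
    by rewrite /path_mass -/(bal A0) bA0 ffunE A0a.
  rewrite /path_mass -/(bal A); case: ifP => // bA.
  by rewrite (uniq_path A A0) ?eqxx ?Aa ?A0a in AA0.
rewrite big1 ?exit_mass_ge0 // => A Aa; rewrite /path_mass -/(bal A).
by have := noA A; rewrite Aa andbT => ->.
Qed.

Definition trace K (hat : pred 'I_N) h eta : R[i] :=
  \sum_(A : boxed_path n N K) pweight hat h eta (unbox_path A).

Lemma bounded_trace hat h eta : has_color m eta ->
  bounded_seq (fun K => trace K hat h eta).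
Proof.
move=> /existsP[j0 /eqP etam]; have [c c0 cP] := pweight_bound.
exists (c * ((1 - q)^-1) ^+ n) => K.
apply: le_trans (cnorm_sum _ _) _.
apply: le_trans (_ : _ <= c *
  \sum_(A : boxed_path n N K) path_mass h eta j0 (unbox_path A)) _.
  by rewrite mulr_sumr; apply: ler_sum => A _; apply: cP.
by apply: ler_wpM2l => //; apply: sum_path_mass.
Qed.

Definition trace_on K (P : pred {ffun 'I_N -> vtuple n}) hat h eta : R[i] :=
  \sum_(A : boxed_path n N K.+1 | P (unbox_path A)) pweight hat h eta (unbox_path A).

(** The sums differ by paths in the box [K.+1] but not in the box [K]; their mass is an increment of
    a bounded monotone sequence. *)
Lemma trace_on_null (P : nat -> pred {ffun 'I_N -> vtuple n}) hat h eta :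
  (forall K A, path_in_box K A -> P K A) -> has_color m eta ->
  null (fun K => trace_on K (P K) hat h eta - trace K hat h eta).
Proof.
move=> boxP /existsP[j0 /eqP etam]; have [c c0 cP] := pweight_bound.
pose b K := c * \sum_(A : boxed_path n N K) path_mass h eta j0 (unbox_path A).
have bS K : b K.+1 - b K = c * \sum_(A : boxed_path n N K.+1 |
    ~~ path_in_box K (unbox_path A)) path_mass h eta j0 (unbox_path A).
  rewrite -mulrBr; congr (_ * _).
  rewrite (bigID (fun A : boxed_path n N K.+1 => path_in_box K (unbox_path A))) /=.
  by rewrite (sum_boxed_path _ (leqnSn K)) addrC addrK.
apply: (@null_le _ _ (fun K => b K.+1 - b K)).
  apply: (@increments_to0 _ b (c * ((1 - q)^-1) ^+ n)) => K.
    rewrite -subr_ge0 bS mulr_ge0 // sumr_ge0 // => A _.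
    exact: path_mass_ge0.
  by apply: ler_wpM2l => //; apply: sum_path_mass.
move=> K; rewrite bS /trace_on /trace -(sum_boxed_path _ (leqnSn K)).
rewrite (bigID (fun A : boxed_path n N K.+1 => path_in_box K (unbox_path A))) /= addrAC.
rewrite [X in X - _](eq_bigl (fun A : boxed_path n N K.+1 =>
  path_in_box K (unbox_path A))); last first.
  by move=> A; case: (boolP (path_in_box K (unbox_path A))) => [/boxP ->|];
    rewrite ?andbF.
rewrite subrr add0r mulr_sumr; apply: le_trans (cnorm_sum _ _) _.
rewrite [leRHS](bigID (fun A : boxed_path n N K.+1 => P K (unbox_path A))) /=.
rewrite [X in _ <= X + _](eq_bigl (fun A : boxed_path n N K.+1 =>
  P K (unbox_path A) && ~~ path_in_box K (unbox_path A))); last first.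
  by move=> A; rewrite andbC.
rewrite -[leLHS]addr0; apply: lerD.
  by apply: ler_sum => A _; apply: cP.
by apply: sumr_ge0 => A _; rewrite mulr_ge0 // path_mass_ge0.
Qed.

(** Only the vertices [j] and [e], distinct as [1 < N], see the tuple at [e]. *)
Lemma pweight_update K (j : 'I_N) hat h eta (A : boxed_path n N K) b (e := ordS j) :
  pweight hat h eta (unbox_path (update A e b)) =
  vweight q s z m (hat j) (unbox (A j)) (h j) (unbox b) (eta j) *
  vweight q s z m (hat e) (unbox b) (h e) (unbox (A (ordS e))) (eta e) *
  \prod_(i < N | (i != j) && (i != e)) vweight q s z m (hat i) (unbox (A i))
     (h i) (unbox (A (ordS i))) (eta i).
Proof.
have ej : e != j by apply: ordS_neq.
have ee : ordS e != e by apply: ordS_neq.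
rewrite /pweight (bigD1 j) //= (bigD1 e) //= mulrA.
rewrite !ffunE eqxx (negPf ee) eq_sym (negPf ej); congr (_ * _).
apply: eq_bigr => i /andP[ij ie]; rewrite !ffunE (negPf ie).
by rewrite (inj_eq (@ordS_inj N)) (negPf ij).
Qed.

Definition relaxed_box (j : 'I_N) K A : bool :=
  [forall i, (i != j) ==> in_box K (A i)].

(* Once the middle tuple of the bond [j, ordS j] is allowed to leave the box, the *)
(* local relation applies exactly.                                              *)
Lemma bond_relation K (j : 'I_N) h eta
    (Y := trace_on K (relaxed_box (ordS j) K)) :
  rate q%:C (eta (ordS j)) (eta j) * Y pred0 h (swap_sites j eta)
  - rate q%:C (eta j) (eta (ordS j)) * Y pred0 h eta
  - rate q%:C (h j) (h (ordS j)) * (Y pred0 (swap_sites j h) eta - Y pred0 h eta)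
  - (1 - q%:C) * (Y (pred1 j) h eta - Y (pred1 (ordS j)) h eta) = 0.
Proof.
rewrite /Y /trace_on -!sumrB !mulr_sumr -!sumrB.
have ej : ordS j != j by apply: ordS_neq.
have je : j != ordS j by rewrite eq_sym.
have ee : ordS (ordS j) != ordS j by apply: ordS_neq.
(* The middle tuple is summed first, the others being fixed. *)
apply: (@sum_update0 _ _ _ (ordS j)) => [A b|A /forallP AK].
  apply: eq_forallb => i; rewrite !ffunE.
  by case: eqP.
have jK : in_box K (unbox (A j)) by have := AK j; rewrite je ffunE.
have lt_n (c : 'I_n.+1) : (c <= n)%N by rewrite -ltnS.
set r := \prod_(i < N | (i != j) && (i != ordS j)) vweight q s z m false (unbox (A i))
     (h i) (unbox (A (ordS i))) (eta i).
have pwE hat h' eta' b :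
    (forall i, i != j -> i != ordS j -> [/\ hat i = false, h' i = h i & eta' i = eta i]) ->
    pweight hat h' eta' (unbox_path (update A (ordS j) b)) =
    r * (vweight q s z m (hat j) (unbox (A j)) (h' j) (unbox b) (eta' j) *
    vweight q s z m (hat (ordS j)) (unbox b) (h' (ordS j))
      (unbox (A (ordS (ordS j)))) (eta' (ordS j))).
  move=> out; rewrite pweight_update mulrC; congr (_ * _).
  by apply: eq_bigr => i /andP[ij ie]; have [-> -> ->] := out i ij ie.
have outs (xi : state n N) i : i != j -> i != ordS j -> swap_sites j xi i = xi i.
  by move=> ij ie; rewrite ffunE tpermD // eq_sym.
have := local_relation q s z m (unbox (A (ordS (ordS j)))) jK (lt_n (h j))
  (lt_n (h (ordS j))) (lt_n (eta j)) (lt_n (eta (ordS j))).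
move=> /(congr1 (fun x => r * x)); rewrite mulr0 => loc; rewrite -[RHS]loc.
rewrite -!sumrB !mulr_sumr -!sumrB !mulr_sumr; apply: eq_bigr => b _.
rewrite !pwE; first 1 last.
- by move=> i ij ie; rewrite /= (negPf ie).
- by move=> i ij ie; rewrite /= (negPf ij).
- by move=> i ij ie; rewrite outs.
- by [].
- by move=> i ij ie; rewrite outs.
rewrite /= !swap_sitesL !swap_sitesR !eqxx (negPf ej) (negPf je).
clear loc pwE; move: r => r.
do 8!move: (vweight q s z m _ _ _ _ _) => ?.
do 3!move: (rate _ _ _) => ?.
move: q%:C => ?; ring.
Qed.

(** The bond relations are summed around the ring; passing from relaxed to strict boxes costs the
    errors [E], which are null. *)
Lemma trace_defect h eta : has_color m eta ->
  null (fun K => flow q%:C (trace K pred0 h) eta -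
    \sum_(j < N) rate q%:C (h j) (h (ordS j)) *
      (trace K pred0 (swap_sites j h) eta - trace K pred0 h eta)).
Proof.
move=> etam.
pose E j (hat : pred 'I_N) h' eta' K :=
  trace_on K (relaxed_box (ordS j) K) hat h' eta' - trace K hat h' eta'.
have Enull j hat h' eta' : has_color m eta' -> null (E j hat h' eta').
  move=> etam'; apply: trace_on_null => // K A /forallP Ain.
  by apply/forallP => i; rewrite Ain implybT.
have etam' j : has_color m (swap_sites j eta) by rewrite has_color_swap.
set u := (X in null X).
have -> : u = fun K => \sum_(j < N)
    (- rate q%:C (eta (ordS j)) (eta j) * E j pred0 h (swap_sites j eta) K +
    (rate q%:C (eta j) (eta (ordS j)) * E j pred0 h eta K +
    (rate q%:C (h j) (h (ordS j)) * E j pred0 (swap_sites j h) eta K +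
    (- rate q%:C (h j) (h (ordS j)) * E j pred0 h eta K +
    ((1 - q%:C) * E j (pred1 j) h eta K +
     (- (1 - q%:C)) * E j (pred1 (ordS j)) h eta K))))).
  apply/funext => K; rewrite /u /flow -sumrB.
  (* Each site carries [D] once with either sign. *)
  have tel : \sum_(j < N) (1 - q%:C) *
      (trace K (pred1 j) h eta - trace K (pred1 (ordS j)) h eta) = 0.
    rewrite -mulr_sumr sumrB [X in _ * (X - _)](reindex_inj (@ordS_inj N)).
    by rewrite subrr mulr0.
  rewrite -[LHS]subr0 -[X in _ - X = _]tel -sumrB; apply: eq_bigr => j _; rewrite /E.
  have := bond_relation K j h eta; cbv zeta.
  move: (trace_on _ _ _ _ _) (trace_on _ _ _ _ _) (trace_on _ _ _ _ _)
    (trace_on _ _ _ _ _) (trace_on _ _ _ _ _) => y1 y2 y3 y4 y5 L0.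
  rewrite -[LHS]subr0 -L0.
  move: (trace _ _ _ _) (trace _ _ _ _) (trace _ _ _ _) (trace _ _ _ _)
    (trace _ _ _ _) => t1 t2 t3 t4 t5.
  ring.
apply: null_sum => j _.
by do 5?[apply: nullD]; apply: nullZ; apply: Enull.
Qed.

(** Summed around the ring, the vertical entries of a color above [m] cancel. *)
Lemma pweight_count hat h eta A (i : 'I_n) : pweight hat h eta A != 0 ->
  (m < i)%N -> #|[set j | h j == color i]| = #|[set j | eta j == color i]|.
Proof.
move=> w0 mi.
have [aA bal] : (forall j, adm m (A j)) /\
    forall j, balanced (A j) (h j) (A (ordS j)) (eta j).
  have ok j : adm m (A j) && balanced (A j) (h j) (A (ordS j)) (eta j).
    have /prodf_neq0/(_ j isT) := w0; rewrite /vweight.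
    by case: ifP => [/and3P[-> _ ->]|]; rewrite ?eqxx.
  by split=> j; case/andP: (ok j).
pose a j := odflt 0%N (A j i).
have step j : ((h j == color i) + a j = (eta j == color i) + a (ordS j))%N.
  have := balancedP _ _ _ _ (bal j) i; rewrite /a.
  case: (A j i) (adm_gt (aA j) mi) (A (ordS j) i) (adm_gt (aA (ordS j)) mi).
    move=> x _ [y|] //= _ [xy]; rewrite !eq_color; exact: xy.
  by [].
have sumE (xi : state n N) : (#|[set j | xi j == color i]| =
    \sum_(j < N) (xi j == color i))%N.
  by rewrite -sum1dep_card big_mkcond; apply: eq_bigr => j _; case: ifP.
rewrite !sumE; apply: (@addIn (\sum_(j < N) a j)%N).
rewrite -big_split (eq_bigr _ (fun j _ => step j)) big_split /=; congr (_ + _)%N.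
by rewrite [RHS](reindex_inj (@ordS_inj N)).
Qed.

(** Supplies the next columns with the exiting colors that their estimates require. *)
Lemma trace_color K hat h eta (i : 'I_n) : trace K hat h eta != 0 -> (m < i)%N ->
  has_color i eta -> has_color i h.
Proof.
move=> t0 mi /existsP[j ej].
have /existsP[A w0] : [exists A : boxed_path n N K, pweight hat h eta (unbox_path A) != 0].
  apply: contraT => /existsPn all0; move: t0; rewrite /trace big1 ?eqxx // => A _.
  by apply/eqP; rewrite -[_ == _]negbK all0.
have cE := pweight_count w0 mi.
have : (0 < #|[set j | h j == color i]|)%N.
  by rewrite cE; apply/card_gt0P; exists j; rewrite inE.
by case/card_gt0P => k; rewrite inE => hk; apply/existsP; exists k.
Qed.

End ColumnTrace.

(** * The partition function *)

Definition hole n N : state n N := [ffun=> ord0].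

(** [U ord0] is the outermost column, with output [eta]. The number [n'] of columns is kept apart
    from the number [n] of colors so that the recursion can lower it. *)
Fixpoint iterated (C : comNzRingType) n N n' :
    ('I_n' -> state n N -> state n N -> C) -> state n N -> C :=
  if n' is n''.+1 then fun U eta =>
    \sum_h U ord0 h eta * iterated (fun m => U (lift ord0 m)) h
  else fun _ eta => (eta == hole n N)%:R.

Section Iteration.
Variables (R : realType) (n N : nat) (q : R[i]).
Implicit Types (h eta : state n N).

Lemma flow_hole eta : flow q (fun eta => (eta == hole n N)%:R) eta = 0.
Proof.
rewrite /flow big1 // => k _.
have -> : (swap_sites k eta == hole n N) = (eta == hole n N).
  rewrite -(inj_eq (inv_inj (@swap_sitesK n N k))) swap_sitesK; congr (_ == _).
  by apply/ffunP => j; rewrite !ffunE.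
case: eqP => [->|]; last by rewrite !mulr0 subr0.
by rewrite !ffunE subrr.
Qed.

(** Induction on columns: summation by parts splits the flow of [U V] into the intertwining defect
    of [U] against [V], and [U] against the flow of [V]. Both are bounded times null. [P r]
    describes the states on which columns from [r] on are controlled. *)
Lemma iterated_flow n' (U : nat -> 'I_n' -> state n N -> state n N -> R[i])
    (P : nat -> pred (state n N)) :
  (forall r k eta, P r (swap_sites k eta) = P r eta) ->
  (forall K (m : 'I_n') h eta, U K m h eta != 0 -> P m eta -> P m.+1 h) ->
  (forall (m : 'I_n') h eta, P m eta -> bounded_seq (fun K => U K m h eta)) ->
  (forall (m : 'I_n') h eta, P m eta -> null (fun K => flow q (U K m h) eta -
     \sum_(j < N) rate q (h j) (h (ordS j)) *
       (U K m (swap_sites j h) eta - U K m h eta))) ->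
  forall eta, P 0 eta -> bounded_seq (fun K => iterated (U K) eta) /\
    null (fun K => flow q (iterated (U K)) eta).
Proof.
elim: n' U P => [|n' IH] U P Pswap Ucol Ubd Uflow eta P0.
  split; first by exists (cnorm (eta == hole n N)%:R : R).
  move=> e e0; exists 0%N => K _; rewrite flow_hole cnorm0; exact: ltW.
pose V K m := U K (lift ord0 m).
have IH' h (Ph : P 1%N h) := IH V (fun r => P r.+1) (fun r => Pswap r.+1)
  (fun K m => Ucol K (lift ord0 m)) (fun m => Ubd (lift ord0 m))
  (fun m => Uflow (lift ord0 m)) h Ph.
(* Intermediate states outside [P 1], where [V] is not controlled, have amplitude [0]. *)
have U0 K h xi : ~~ P 1 h -> P 0 xi -> U K ord0 h xi = 0.
  move=> nP Pxi; apply/eqP; apply: contraNT nP => Un0.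
  exact: (Ucol _ _ _ _ Un0).
split.
  apply: bounded_seq_sum => h; have [Ph|nPh] := boolP (P 1%N h).
    by apply: bounded_seqM; [exact: Ubd|exact: (IH' _ _).1].
  by exists 0 => K; rewrite U0 // mul0r cnorm0.
set u := (X in null X).
have -> : u = fun K => \sum_h iterated (V K) h * (flow q (U K ord0 h) eta -
     \sum_(j < N) rate q (h j) (h (ordS j)) *
       (U K ord0 (swap_sites j h) eta - U K ord0 h eta)) +
    \sum_h U K ord0 h eta * flow q (iterated (V K)) h.
  apply/funext => K; rewrite /u.
  under [X in _ = _ + X]eq_bigr do rewrite mulrC.
  rewrite flow_adjoint -big_split /=.
  under [RHS]eq_bigr do rewrite mulrBr subrK /flow mulr_sumr.
  rewrite exchange_big /flow; apply: eq_bigr => k _ /=.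
  rewrite -/(V K) !mulr_sumr -sumrB; apply: eq_bigr => h _.
  by move: (rate _ _ _) (rate _ _ _) (U _ _ _ _) (U _ _ _ _) (iterated _ _) => *; ring.
apply: nullD; apply: null_sum => h _; have [Ph|nPh] := boolP (P 1%N h).
- by apply: null_bounded; [exact: (IH' _ _).1|exact: Uflow].
- move=> e e0; exists 0%N => K _; rewrite /flow.
  rewrite big1 => [|k _]; last by rewrite !U0 ?Pswap // !mulr0 subrr.
  rewrite big1 => [|k _]; last by rewrite !U0 ?Pswap // subrr mulr0.
  by rewrite subrr mulr0 cnorm0 ltW.
- by apply: null_bounded; [exact: Ubd|exact: (IH' _ _).2].
- by move=> e e0; exists 0%N => K _; rewrite U0 // mul0r cnorm0 ltW.
Qed.

End Iteration.

(** Row [0] is split off and row [1] becomes the new boundary state. *)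
Lemma iterated_path_sum (C : comNzRingType) n N n'
    (U : 'I_n' -> state n N -> state n N -> C) eta :
  \sum_(rho : {ffun 'I_n'.+1 -> state n N} |
      (rho ord0 == eta) && (rho ord_max == hole n N))
    \prod_(m < n') U m (rho (lift ord0 m)) (rho (widen_ord (leqnSn n') m))
  = iterated U eta.
Proof.
elim: n' U eta => [|n' IH] U eta /=.
  under eq_bigr do rewrite big_ord0.
  have [->|ne] := eqVneq eta (hole n N).
    rewrite (big_pred1 [ffun=> hole n N]) // => rho; rewrite (ord1 ord_max) andbb.
    apply/eqP/eqP => [r0|->]; last by rewrite ffunE.
    by apply/ffunP => i; rewrite (ord1 i) ffunE.
  by rewrite big1 // => rho /andP[/eqP r0]; rewrite (ord1 ord_max) r0 (negPf ne).
pose ext (h : {ffun 'I_n'.+1 -> state n N}) : {ffun 'I_n'.+2 -> state n N} :=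
  [ffun i => if unlift ord0 i is Some i' then h i' else eta].
pose res (rho : {ffun 'I_n'.+2 -> state n N}) : {ffun 'I_n'.+1 -> state n N} :=
  [ffun i => rho (lift ord0 i)].
have extS h i : ext h (lift ord0 i) = h i by rewrite ffunE liftK.
have ext0 h : ext h ord0 = eta by rewrite ffunE unlift_none.
rewrite (reindex_onto ext res) /=; last first.
  move=> rho /andP[/eqP r0 _]; apply/ffunP => i; rewrite ffunE.
  by case: unliftP => [i' ->|->]; rewrite ?ffunE.
have max_lift : ord_max = lift ord0 ord_max :> 'I_n'.+2 by apply/val_inj.
transitivity (\sum_(h : {ffun 'I_n'.+1 -> state n N} | h ord_max == hole n N)
    U ord0 (h ord0) eta *
    \prod_(m < n') U (lift ord0 m) (h (lift ord0 m)) (h (widen_ord (leqnSn n') m))).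
  apply: eq_big => [h|h _].
    rewrite ext0 eqxx max_lift extS andbC /=; case: eqP => //= ne.
    by case: ne; apply/ffunP => i; rewrite ffunE extS.
  rewrite big_ord_recl extS.
  have -> : widen_ord (leqnSn n'.+1) ord0 = ord0 by apply/val_inj.
  rewrite ext0; congr (_ * _); apply: eq_bigr => m _; rewrite extS.
  have -> : widen_ord (leqnSn n'.+1) (lift ord0 m) = lift ord0 (widen_ord (leqnSn n') m).
    by apply/val_inj.
  by rewrite extS.
rewrite (partition_big (fun h : {ffun 'I_n'.+1 -> state n N} => h ord0) predT) //=.
apply: eq_bigr => h _; rewrite -IH big_distrr /=.
by apply: eq_big => [rho|rho /andP[_ /eqP <-]] //; rewrite andbC.
Qed.

Section Currying.
Variables (I J : finType) (T : finType) (S : nmodType).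

Lemma sum_curry (F : {ffun I * J -> T} -> S) :
  \sum_f F f = \sum_(g : {ffun I -> {ffun J -> T}}) F [ffun p => g p.1 p.2].
Proof.
rewrite (reindex (fun g : {ffun I -> {ffun J -> T}} => [ffun p => g p.1 p.2])) //.
exists (fun f : {ffun I * J -> T} => [ffun i => [ffun j => f (i, j)]]) => f _.
  by apply/ffunP => i; apply/ffunP => j; rewrite !ffunE.
by apply/ffunP => -[i j]; rewrite !ffunE.
Qed.

End Currying.

(** * The partition function as a limit of iterated transfers *)

Section Cylinder.
Variables (R : realType) (n N : nat) (q : R) (s z : 'I_n -> R[i]).
Implicit Types (eta h : state n N) (c : edge_labels n N).

Definition boxed_labels K : finType :=
  ({ffun 'I_n.+1 * 'I_N -> 'I_n.+1} * {ffun 'I_n * 'I_N -> box n K})%type.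

Definition unbox_labels K (c : boxed_labels K) : edge_labels n N :=
  (c.1, [ffun p => unbox (c.2 p)]).

Lemma unbox_labels_inj K : injective (@unbox_labels K).
Proof.
move=> [h A] [h' A'] [-> /ffunP AA']; congr pair; apply/ffunP => p.
by apply: unbox_inj; have := AA' p; rewrite !ffunE.
Qed.

(** Since [vweight] vanishes on inadmissible tuples, only the boundary rows remain as a
    condition. *)
Lemma config_weight_vweight eta c : config_weight q s z eta c =
  if [forall j, c.1 (ord0, j) == eta j] && [forall j, c.1 (ord_max, j) == ord0] then
    \prod_(m < n) \prod_(j < N) vweight q (s m) (z m) m false
        (c.2 (m, j)) (c.1 (lift ord0 m, j))
        (c.2 (m, ordS j)) (c.1 (widen_ord (leqnSn n) m, j))
  else 0.
Proof.
rewrite /config_weight /admissible /=.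
case: [forall j, c.1 (ord0, j) == eta j] => //=.
case: [forall j, c.1 (ord_max, j) == ord0] => //=.
case: ifP => [/forallP adm_c|/negbT/forallPn[m /forallPn[j nadm]]].
  apply: eq_bigr => m _; apply: eq_bigr => j _.
  by have /forallP/(_ j) := adm_c m; apply: queue_weight_vweight.
rewrite (bigD1 m) //= (bigD1 j) //= /vweight.
by rewrite /adm (negPf nadm) /= !mul0r.
Qed.

Definition transfer K (m : 'I_n) h eta : R[i] :=
  trace q (s m) (z m) m K pred0 h eta.

(** For fixed rows the vertical tuples of different columns are independent, so their sum factors
    into one trace per column. *)
Lemma sum_box_config_weight K eta :
  \sum_(c : boxed_labels K) config_weight q s z eta (unbox_labels c) =
  iterated (transfer K) eta.
Proof.
rewrite -iterated_path_sum.
under eq_bigr do rewrite config_weight_vweight.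
rewrite -(pair_big predT predT (fun (h : {ffun 'I_n.+1 * 'I_N -> 'I_n.+1})
    (A : {ffun 'I_n * 'I_N -> box n K}) =>
  if [forall j, h (ord0, j) == eta j] && [forall j, h (ord_max, j) == ord0] then
    \prod_(m < n) \prod_(j < N) vweight q (s m) (z m) m false
        ([ffun p => unbox (A p)] (m, j)) (h (lift ord0 m, j))
        ([ffun p => unbox (A p)] (m, ordS j)) (h (widen_ord (leqnSn n) m, j))
  else 0)) /=.
rewrite sum_curry [RHS]big_mkcond /=; apply: eq_bigr => rho _.
have rowE (i : 'I_n.+1) (xi : state n N) :
    [forall j, [ffun p => rho p.1 p.2] (i, j) == xi j] = (rho i == xi).
  apply/forallP/eqP => [e|<- j]; last by rewrite ffunE.
  by apply/ffunP => j; have := e j; rewrite ffunE => /eqP.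
have -> : [forall j, [ffun p => rho p.1 p.2] (ord_max, j) == ord0] =
    (rho ord_max == hole n N).
  by rewrite -rowE; apply: eq_forallb => j; rewrite [X in _ = (_ == X)]ffunE.
rewrite rowE; case: ifP => _; last by rewrite big1.
rewrite /transfer /trace bigA_distr_bigA sum_curry /=.
apply: eq_bigr => A _; apply: eq_bigr => m _; apply: eq_bigr => j _.
by rewrite !ffunE.
Qed.

Definition label_box K : {fset edge_labels n N} :=
  seq_fset tt [seq unbox_labels c | c : boxed_labels K].

Lemma sum_label_box K (f : edge_labels n N -> R[i]) :
  summability.partial_sum f (label_box K) = \sum_(c : boxed_labels K) f (unbox_labels c).
Proof.
rewrite /summability.partial_sum -(big_seq_fsetE _ _ predT f) /label_box.
rewrite -(big_image _ _ (@unbox_labels K) predT f) /=.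
rewrite (perm_big _ (seq_fset_perm tt _)) undup_id //.
by rewrite map_inj_uniq ?enum_uniq //; apply: unbox_labels_inj.
Qed.

(** Boxes are cofinal among finite sets, so the limit of the net can be taken along them. *)
Lemma label_box_cover (J : {fset edge_labels n N}) :
  exists K0, forall K, (K0 <= K)%N -> (J `<=` label_box K)%fset.
Proof.
(* The sum of all finite entries bounds each of them; infinite ones count [0]. *)
pose ht c := (\sum_(p : 'I_n * 'I_N) \sum_(i < n) odflt 0%N (c.2 p i))%N.
exists (\sum_(c <- J) ht c)%N => K JK; apply/fsubsetP => c cJ.
have hK : (ht c <= K)%N.
  by apply: leq_trans JK; rewrite (big_rem c) //= leq_addr.
have /choice[A AE] : forall p, exists a : box n K, c.2 p = unbox a.
  move=> p; apply/in_boxP/forallP => i; case E: (c.2 p i) => [a|] //.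
  apply: leq_trans hK; rewrite /ht (bigD1 p) //= (bigD1 i) //= E /=.
  by rewrite -addnA leq_addr.
rewrite seq_fsetE; apply/mapP; exists (c.1, finfun A); first by rewrite mem_enum.
by rewrite [c]surjective_pairing; congr pair; apply/ffunP => p; rewrite !ffunE -AE.
Qed.

Lemma iterated_transfer_lim eta : partition_finite q s z eta ->
  null (fun K => partition_function q s z eta - iterated (transfer K) eta).
Proof.
move=> cvgF e e0.
have := cvgF; rewrite /partition_finite -/(partition_function q s z eta).
have FF := @summability.totally_filter (edge_labels n N).
move=> /cvgrPdist_le /(_ e%:C); rewrite ltcR => /(_ e0)[J _ JP].
have [K0 K0P] := label_box_cover J; exists K0 => K /K0P /JP /=.
by rewrite sum_label_box sum_box_config_weight -lecR cnormE.
Qed.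

End Cylinder.

(** * Stationarity of the partition function and identification of the law *)

Lemma flow_stationary (R : realType) n N (q : R) (s z : 'I_n -> R[i])
    (q01 : 0 <= q < 1) (N1 : (1 < N)%N) (eta : state n N) :
  (forall xi : state n N, all_colors xi -> partition_finite q s z xi) ->
  all_colors eta -> flow q%:C (partition_function q s z) eta = 0.
Proof.
move=> fin all_eta.
(* [P r] asks for the exit colors of all columns from [r] on, so [P 0] means that all colors
   occur. *)
pose P r (xi : state n N) := [forall c : 'I_n, (r <= c)%N ==> has_color c xi].
have Pswap r k xi : P r (swap_sites k xi) = P r xi.
  by apply: eq_forallb => c; rewrite has_color_swap.
have P0 xi : P 0 xi = all_colors xi by [].
have Pm (m : 'I_n) xi : P m xi -> has_color m xi.
  by move=> /forallP/(_ m); rewrite leqnn.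
have [_ nit] : bounded_seq (fun K => iterated (@transfer R n N q s z K) eta) /\
    null (fun K => flow q%:C (iterated (@transfer R n N q s z K)) eta).
  apply: (iterated_flow Pswap) => [K m h xi t0 Pxi|m h xi /Pm|m h xi /Pm|]; last first.
  - by rewrite P0.
  - exact: trace_defect.
  - exact: bounded_trace.
  apply/forallP => c; apply/implyP => mc.
  apply: (trace_color t0 mc); have := forallP Pxi c.
  by rewrite (ltnW mc).
have lim (xi : state n N) : all_colors xi -> null (fun K =>
    partition_function q s z xi - iterated (transfer q s z K) xi).
  by move=> all_xi; exact: iterated_transfer_lim (fin xi all_xi).
apply: null_const.
set u := (X in null X).
(* The flow of the limit is that of the truncation error plus that of the truncation; both are
   null. *)
have -> : u = fun K => \sum_(k < N)
    (rate q%:C (eta (ordS k)) (eta k) * (partition_function q s z (swap_sites k eta) -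
        iterated (transfer q s z K) (swap_sites k eta)) +
     (- rate q%:C (eta k) (eta (ordS k))) * (partition_function q s z eta -
        iterated (transfer q s z K) eta))
    + flow q%:C (iterated (transfer q s z K)) eta.
  apply/funext => K; rewrite /u /flow -big_split; apply: eq_bigr => k _ /=.
  by move: (rate _ _ _) (rate _ _ _) (iterated _ _) (iterated _ _)
    (partition_function _ _ _ _) (partition_function _ _ _ _) => *; ring.
apply: nullD => //; apply: null_sum => k _.
by apply: nullD; apply: nullZ; apply: lim; rewrite -?P0 ?Pswap ?P0.
Qed.

Theorem proposition4p5 (R : realType) (n N : nat) (q : R) (Nm : 'I_n -> nat)
    (u : R[i]) (v s z : 'I_n -> R[i])
    (hn : (1 <= n)%N) (hN : (2 <= N)%N) (hq : 0 <= q < 1)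
    (hNm : forall m, (1 <= Nm m)%N) (hsum : (\sum_(m < n) Nm m <= N)%N)
    (* For q = 0 the z_m themselves are the parameters. *)
    (hz : 0 < q -> forall m, v m != 0 /\ z m = u / (v m * (Num.sqrt q)%:C))
    (hgen : generic_params N q s z) :
  exists Z : R[i], Z != 0 /\
  exists Prob : {ffun state n N -> R},
    unique (stationary_in_sector q Nm) Prob /\
    forall eta : state n N, eta \in sector N Nm ->
      (Prob eta)%:C = partition_function q s z eta / Z.
Proof.
have [_ gen] := hgen; have q0 : 0 <= q by case/andP: hq.
have sec_all eta : eta \in sector N Nm -> all_colors eta.
  rewrite inE => /forallP cnt; apply/forallP => m; apply/existsP.
  have : (0 < #|[set j | eta j == color m]|)%N by rewrite (eqP (cnt m)).
  by case/card_gt0P => j; rewrite inE; exists j.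
(* Extension by [0] keeps the kernel equation, since swaps preserve the sector. *)
pose f (eta : state n N) : R[i] :=
  if eta \in sector N Nm then partition_function q s z eta else 0.
have fk eta : flow q%:C f eta = 0.
  have [es|ens] := boolP (eta \in sector N Nm); last first.
    rewrite /flow big1 // => k _.
    by rewrite /f sector_swap (negPf ens) !mulr0 subrr.
  have <- := flow_stationary hq hN (fun xi ax => (gen xi ax).1) (sec_all _ es).
  by apply: eq_bigr => k _; rewrite /f sector_swap es.
have rateC a b : rate q%:C a b = (rate q a b)%:C.
  by rewrite /rate; do 2?case: ifP.
(* The rates are real, so real and imaginary parts solve the equation separately. *)
have Rk eta : flow q (fun xi => complex.Re (f xi)) eta = 0.
  transitivity (complex.Re (flow q%:C f eta)); last by rewrite fk.
  rewrite /flow raddf_sum; apply: eq_bigr => k _; rewrite raddfB !rateC /=.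
  by case: (f (swap_sites k eta)) (f eta) => [a b] [c d] /=; rewrite !mul0r !subr0.
have Ik eta : flow q (fun xi => complex.Im (f xi)) eta = 0.
  transitivity (complex.Im (flow q%:C f eta)); last by rewrite fk.
  rewrite /flow raddf_sum; apply: eq_bigr => k _; rewrite raddfB !rateC /=.
  by case: (f (swap_sites k eta)) (f eta) => [a b] [c d] /=; rewrite !mul0r !addr0.
have Rs eta : eta \notin sector N Nm -> complex.Re (f eta) = 0.
  by move=> /negPf es; rewrite /f es.
have Is eta : eta \notin sector N Nm -> complex.Im (f eta) = 0.
  by move=> /negPf es; rewrite /f es.
have [eta0 es0] := sector_nonempty hsum.
have f0 : f eta0 != 0 by rewrite /f es0; apply: (gen _ (sec_all _ es0)).2.
(* Whichever part is nonzero at [eta0] serves as the nonzero real solution. *)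
have [pi [pi_uniq piP]] : exists pi : {ffun state n N -> R},
    unique (stationary_in_sector q Nm) pi /\
    forall g', (forall eta, eta \notin sector N Nm -> g' eta = 0) ->
      (forall eta, flow q g' eta = 0) -> exists c, forall eta, g' eta = c * pi eta.
  have [R0|Rn] := eqVneq (complex.Re (f eta0)) 0.
    apply: (kernel_stationary q0 Is Ik); exists eta0.
    by apply: contra f0 => /eqP I0; rewrite eq_complex R0 I0 !eqxx.
  by apply: (kernel_stationary q0 Rs Rk); exists eta0.
have [[a aP] [b bP]] := (piP _ Rs Rk, piP _ Is Ik).
(* Both parts are multiples of [pi]; the two factors form the constant [Z]. *)
have fE eta : f eta = (a +i* b) * (pi eta)%:C.
  by rewrite [f eta]complexE aP bP; apply/eqP;
    rewrite eq_complex /=; apply/andP; split; apply/eqP; ring.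
have Z0 : a +i* b != 0.
  by apply: contraNneq f0 => Z0; rewrite fE Z0 mul0r.
exists (a +i* b); split=> //; exists pi; split=> // eta es.
by have := fE eta; rewrite /f es => ->; rewrite mulrAC divff ?mul1r.
Qed.
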